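(* Let $k$ be an algebraically closed field of characteristic $p>2$ and let $k[x_1,\dots,x_n]$, with Poisson bivector field $\pi$ and torus $\mathbb T$, be a Poisson CGL extension. If the rank of $\pi$ is equal to the rank of its log-canonical part $\pi_0$, then a Frobenius Poisson $\mathbb T$-Pfaffian exists for $\pi$ (on the affine space with coordinate ring $k[x_1,\dots,x_n]$).
   Context: **Poisson CGL extension.** Let $\mathbb T$ be an algebraic torus over $k$ with Lie algebra $\mathfrak t$. A Poisson CGL extension is a polynomial algebra $k[x_1,\dots,x_n]$ with a Poisson bracket and a rational (i.e. weight-space decomposable) action of $\mathbb T$ by Poisson algebra automorphisms for which each $x_i$ is a $\mathbb T$-eigenvector, with $\lambda_i\in\mathfrak t^*$ the differential of the weight of $x_i$, together with elements $h_1,\dots,h_n\in\mathfrak t$ such that for $1\le i\le n$: (a) for all $j>i$, $\{x_i,x_j\}=\lambda_j(h_i)x_ix_j+\delta_i(x_j)$, where $\delta_i$ is a locally nilpotent derivation of $k[x_{i+1},\dots,x_n]$ with $\delta_i(x_j)\in k[x_{i+1},\dots,x_{j-1}]$; (b) $\lambda_i(h_i)\ne0$. Its bivector field is $\pi=\sum_{i<j}(\lambda_j(h_i)x_ix_j+\delta_i(x_j))\,\partial_i\wedge\partial_j$ (a Poisson CGL bivector field), $\partial_i=\partial/\partial x_i$, and its log-canonical part is $\pi_0=\sum_{i<j}\lambda_j(h_i)x_ix_j\,\partial_i\wedge\partial_j$. **Rank.** For a bivector field $\pi$ and $r\ge1$, $\pi^{[r]}$ is the $2r$-vector field $$\pi^{[r]}(a_1,\dots,a_{2r})=\sum_{\sigma}\mathrm{sgn}(\sigma)\,\pi(a_{\sigma(1)},a_{\sigma(2)})\cdots\pi(a_{\sigma(2r-1)},a_{\sigma(2r)}),$$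 the sum over $\sigma\in S_{2r}$ with $\sigma(1)<\sigma(3)<\cdots<\sigma(2r-1)$ and $\sigma(2i-1)<\sigma(2i)$ for all $i$; $\pi^{[0]}=1$. The rank of $\pi$ is $2r$, with $r$ the largest integer such that $\pi^{[r]}\neq0$. **Pfaffians.** For $h\in\mathfrak t$, the vector field generated by $h$ is $\partial_h=\sum_i\lambda_i(h)x_i\partial_i$. A Poisson $\mathbb T$-Pfaffian is a non-zero section $\sigma$ of the anti-canonical bundle $\omega_X^{-1}$, $X=\mathrm{Spec}\,k[x_1,\dots,x_n]$, of the form $\sigma=\pi^{[r]}\wedge\partial_{g_1}\wedge\cdots\wedge\partial_{g_l}$ with $2r=\mathrm{rank}(\pi)$ and $g_1,\dots,g_l\in\mathfrak t$. **Frobenius near-splittings.** Let $F$ be the absolute Frobenius of a non-singular variety $X$ over $k$. A Frobenius near-splitting is an $\mathcal O_X$-linear map $\varphi:F_*\mathcal O_X\to\mathcal O_X$; it is a Frobenius splitting if $\varphi\circ F^\sharp=\mathrm{id}$, where $F^\sharp:\mathcal O_X\to F_*\mathcal O_X$. A section $s\in H^0(X,\omega_X^{1-p})$ defines a near-splitting $\varphi_s$ by $\varphi_s(f)\gamma=C\bigl(f\,(s,\gamma^{p-1})\,\gamma\bigr)$ for $\gamma$ a local generator of $\omega_X$, where $C:F_*\omega_X\to\omega_X$ is the Cartier operator. For $\sigma\in H^0(X,\omega_X^{-1})$ put $\phi_\sigma=\varphi_{\sigma^{p-1}}$. A Frobenius Poisson $\mathbb T$-Pfaffian is a Poisson $\mathbb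 T$-Pfaffian $\sigma$ such that $\phi_{c\sigma}$ is a Frobenius splitting for some non-zero scalar $c\in k$. *)

(* Defs.v *)
From HB Require Import structures.
From mathcomp Require Import all_boot all_order all_algebra all_fingroup.
From mathcomp Require Import mpoly.

Set Implicit Arguments.
Unset Strict Implicit.
Unset Printing Implicit Defensive.

Import GRing.Theory.
Local Open Scope ring_scope.

(* The torus G_m^d: row vectors without zero entry, multiplied entrywise.
   Its Lie algebra is 'rV[k]_d and its character lattice is 'rV[int]_d. *)
Section Torus.
Variables (k : fieldType) (d : nat).

Definition in_torus (t : 'rV[k]_d) : bool := [forall i, t 0 i != 0].

Definition torus_mul (s t : 'rV[k]_d) : 'rV[k]_d := \row_i (s 0 i * t 0 i).

Definition torus_one : 'rV[k]_d := const_mx 1.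

Definition torus_char (w : 'rV[int]_d) (t : 'rV[k]_d) : k :=
  \prod_i t 0 i ^ w 0 i.

Definition dchar (w : 'rV[int]_d) (h : 'rV[k]_d) : k :=
  \sum_i (w 0 i)%:~R * h 0 i.

End Torus.

Section Poisson.
Variables (k : fieldType) (n : nat).
Local Notation A := {mpoly k[n]}.

Record poisson_bracket (br : A -> A -> A) : Prop := PoissonBracket {
  bracket_linearl : forall g, linear (br^~ g);
  bracket_linearr : forall f, linear (br f);
  bracket_alternating : forall f, br f f = 0;
  bracket_leibniz : forall f g h, br f (g * h) = br f g * h + g * br f h;
  bracket_jacobi : forall f g h,
    br f (br g h) + br g (br h f) + br h (br f g) = 0
}.

(* The subalgebra of A generated by the variables x_l with P l. *)
Definition in_vars (P : pred 'I_n) (f : A) : bool :=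
  all (fun m : 'X_{1..n} => [forall l, (m l != 0%N) ==> P l]) (msupp f).

Record nilpotent_derivation_on (S : pred A) (D : A -> A) : Prop :=
  NilpotentDerivationOn {
  der_stable : forall f, S f -> S (D f);
  der_linear : forall (c : k) f g, S f -> S g -> D (c *: f + g) = c *: D f + D g;
  der_leibniz : forall f g, S f -> S g -> D (f * g) = D f * g + f * D g;
  der_nilpotent : forall f, S f -> exists N, iter N D f = 0
}.

End Poisson.

Section CGL.
Variables (k : fieldType) (n d : nat).
Local Notation A := {mpoly k[n]}.

Definition weight_vector (act : 'rV[k]_d -> A -> A) (w : 'rV[int]_d) (f : A) :=
  forall t, in_torus t -> act t f = torus_char w t *: f.

Record rational_action (act : 'rV[k]_d -> A -> A) : Prop := RationalAction {
  act_one : forall f, act (torus_one k d) f = f;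
  act_mul : forall s t f, in_torus s -> in_torus t ->
    act (torus_mul s t) f = act s (act t f);
  act_linear : forall t, in_torus t -> linear (act t);
  act_multiplicative : forall t, in_torus t -> monoid_morphism (act t);
  act_weights : forall f, exists2 s : seq ('rV[int]_d * A),
    f = \sum_(u <- s) u.2 & forall u, u \in s -> weight_vector act u.1 u.2
}.

(* A Poisson CGL extension k[x_1, ..., x_n]; cgl_wt j is the weight of x_j.
   The values of cgl_act outside the torus and those of cgl_delta i outside
   k[x_{i+1}, ..., x_n] are irrelevant. *)
Record poissonCGL := PoissonCGL {
  cgl_bracket : A -> A -> A;
  cgl_act : 'rV[k]_d -> A -> A;
  cgl_wt : 'I_n -> 'rV[int]_d;
  cgl_h : 'I_n -> 'rV[k]_d;
  cgl_delta : 'I_n -> A -> A;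
  cgl_poisson : poisson_bracket cgl_bracket;
  cgl_rational : rational_action cgl_act;
  cgl_act_poisson : forall t f g, in_torus t ->
    cgl_act t (cgl_bracket f g) = cgl_bracket (cgl_act t f) (cgl_act t g);
  cgl_eigen : forall i, weight_vector cgl_act (cgl_wt i) 'X_i;
  cgl_derivation : forall i : 'I_n,
    nilpotent_derivation_on (in_vars (fun l : 'I_n => (i < l)%N)) (cgl_delta i);
  cgl_delta_var : forall i j : 'I_n, (i < j)%N ->
    in_vars (fun l : 'I_n => (i < l < j)%N) (cgl_delta i 'X_j);
  cgl_relation : forall i j : 'I_n, (i < j)%N ->
    cgl_bracket 'X_i 'X_j =
      dchar (cgl_wt j) (cgl_h i) *: ('X_i * 'X_j) + cgl_delta i 'X_j;
  cgl_diag : forall i, dchar (cgl_wt i) (cgl_h i) != 0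
}.

End CGL.

Section Multivectors.
Variables (k : fieldType) (n : nat).
Local Notation A := {mpoly k[n]}.

(* m-vector fields on affine n-space are given by their values on m-tuples of
   functions. *)
Definition mvfield (m : nat) := ('I_m -> A) -> A.

Definition mv_nonzero m (P : mvfield m) := exists a, P a != 0.

Definition mv_scale m (c : k) (P : mvfield m) : mvfield m := fun a => c *: P a.

(* (d/dx_i /\ d/dx_j)(f, g) = f_i g_j - f_j g_i, without a factor 1/2. *)
Definition bivector (c : 'I_n -> 'I_n -> A) (f g : A) : A :=
  \sum_(i < n) \sum_(j < n | (i < j)%N)
    c i j * (f^`M(i) * g^`M(j) - f^`M(j) * g^`M(i)).

Definition pair_fst r (i : 'I_r) : 'I_r.*2 :=
  Ordinal (etrans (ltn_double i r) (ltn_ord i)).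

Definition pair_snd r (i : 'I_r) : 'I_r.*2 :=
  Ordinal (etrans (ltn_Sdouble i r) (ltn_ord i)).

Definition pairing_perm r (s : 'S_r.*2) : bool :=
  [forall i : 'I_r, forall j : 'I_r,
     (i < j)%N ==> (s (pair_fst i) < s (pair_fst j))%N] &&
  [forall i : 'I_r, (s (pair_fst i) < s (pair_snd i))%N].

Definition bivector_pow (pi : A -> A -> A) (r : nat) : mvfield r.*2 := fun a =>
  \sum_(s : 'S_r.*2 | pairing_perm s)
    (-1) ^+ s * \prod_(i < r) pi (a (s (pair_fst i))) (a (s (pair_snd i))).

Definition has_rank (pi : A -> A -> A) (m : nat) :=
  exists r, [/\ m = r.*2, mv_nonzero (@bivector_pow pi r)
              & forall s, mv_nonzero (@bivector_pow pi s) -> (s <= r)%N].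

(* The wedge product is the signed sum over (m, l)-shuffles, without
   factorials; with this convention the r-fold wedge power of a bivector field
   pi is r! times bivector_pow pi r. *)
Definition shuffle m l (s : 'S_(m + l)) : bool :=
  [forall i : 'I_m, forall j : 'I_m,
     (i < j)%N ==> (s (lshift l i) < s (lshift l j))%N] &&
  [forall i : 'I_l, forall j : 'I_l,
     (i < j)%N ==> (s (rshift m i) < s (rshift m j))%N].

Definition mv_wedge m l (P : mvfield m) (Q : mvfield l) : mvfield (m + l) :=
  fun a => \sum_(s : 'S_(m + l) | shuffle s)
    (-1) ^+ s * (P (fun i => a (s (lshift l i))) * Q (fun j => a (s (rshift m j)))).

(* v_1 /\ ... /\ v_l, in the same convention *)
Definition vf_wedge l (v : 'I_l -> A -> A) : mvfield l := fun a =>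
  \det (\matrix_(i < l, j < l) v i (a j)).

End Multivectors.

Section Pfaffians.
Variables (k : fieldType) (n d : nat) (X : poissonCGL k n d).
Local Notation A := {mpoly k[n]}.

Definition cgl_lambda (j : 'I_n) (h : 'rV[k]_d) : k := dchar (cgl_wt X j) h.

Definition cgl_pi : A -> A -> A := bivector (fun i j =>
  cgl_lambda j (cgl_h X i) *: ('X_i * 'X_j) + cgl_delta X i 'X_j).

Definition cgl_pi0 : A -> A -> A := bivector (fun i j =>
  cgl_lambda j (cgl_h X i) *: ('X_i * 'X_j)).

Definition generated_vf (h : 'rV[k]_d) (f : A) : A :=
  \sum_(i < n) cgl_lambda i h *: ('X_i * f^`M(i)).

(* Sections of the anti-canonical bundle are the n-vector fields. *)
Definition poisson_pfaffian (sigma : mvfield k n n) :=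
  mv_nonzero sigma /\
  exists (r l : nat) (e : (r.*2 + l)%N = n) (g : 'I_l -> 'rV[k]_d),
    has_rank cgl_pi r.*2 /\
    forall a, sigma a =
      mv_wedge (@bivector_pow k n cgl_pi r) (vf_wedge (fun i => generated_vf (g i)))
        (fun i => a (cast_ord e i)).

End Pfaffians.

(* The canonical bundle is trivialised by gamma = dx_1 /\ ... /\ dx_n, so that
   top forms f gamma and maps on them are given by f. *)
Section Frobenius.
Variables (k : fieldType) (n p : nat).
Local Notation A := {mpoly k[n]}.

(* df_1 /\ ... /\ df_n = jacobian f * gamma *)
Definition jacobian (f : 'I_n -> A) : A := \det (\matrix_(i, j) (f i)^`M(j)).

(* The Cartier operator on top forms: it induces the inverse of the Cartier
   isomorphism
     f_0 df_1 /\ ... /\ df_n |->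
       f_0^p f_1^(p-1) df_1 /\ ... /\ f_n^(p-1) df_n  modulo exact forms,
   where the exact top forms are spanned by the (d g / d x_i) gamma. *)
Record cartier_operator (C : A -> A) : Prop := CartierOperator {
  cartierD : {morph C : f g / f + g};
  cartier_exact : forall i g, C (g^`M(i)) = 0;
  cartier_inverse : forall f0 (f : 'I_n -> A),
    C (f0 ^+ p * \prod_i f i ^+ p.-1 * jacobian f) = f0 * jacobian f
}.

Record near_splitting (phi : A -> A) : Prop := NearSplitting {
  near_splittingD : {morph phi : f g / f + g};
  near_splittingM : forall f g, phi (f ^+ p * g) = f * phi g
}.

Definition frobenius_splitting (phi : A -> A) :=
  near_splitting phi /\ forall f, phi (f ^+ p) = f.

(* The near-splitting of a section s of omega^(1-p), s being given by its
   pairing with gamma^(p-1). *)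
Definition section_near_splitting (C : A -> A) (s : A) : A -> A :=
  fun f => C (f * s).

(* The pairing with gamma, for which d/dx_1 /\ ... /\ d/dx_n pairs to 1 *)
Definition gamma_pairing (sigma : mvfield k n n) : A := sigma (fun i => 'X_i).

Definition anticanonical_near_splitting (C : A -> A) (sigma : mvfield k n n) :=
  section_near_splitting C (gamma_pairing sigma ^+ p.-1).

End Frobenius.

Definition frobenius_poisson_pfaffian (k : fieldType) (n d p : nat)
    (C : {mpoly k[n]} -> {mpoly k[n]}) (X : poissonCGL k n d)
    (sigma : mvfield k n n) :=
  poisson_pfaffian X sigma /\
  exists2 c : k, c != 0 &
    frobenius_splitting p
      (anticanonical_near_splitting p C (mv_scale c sigma)).

(* Main.v *)
Require Import Defs.
From Stdlib Require Import FunctionalExtensionality.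
From mathcomp Require Import all_boot all_order all_algebra all_fingroup zify ring.
From mathcomp Require Import mpoly.
Import GRing.Theory.
Local Open Scope ring_scope.

Set Implicit Arguments.
Unset Strict Implicit.
Unset Printing Implicit Defensive.

(* Let L be the skew matrix of the log-canonical part and M i j = lambda_j(h_i).
   Since M - L is triangular with non-zero diagonal, the rows of M restrict to
   all linear forms on the kernel of L; a symplectic basis of L completed by a
   basis of the kernel then shows that rank L = 2s and that the coefficient s0
   of x_1 ... x_n in pi0^[s] /\ d_g1 /\ ... /\ d_gl is non-zero for suitable
   combinations g of the h_i.
   In the lexicographic order with x_1 > ... > x_n, every monomial of
   delta_i(x_j) is smaller than x_i x_j, so sigma = pi^[s] /\ d_g1 /\ ... /\ d_gl
   is s0 x_1 ... x_n plus lower terms. A monomial lower than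
   (x_1 ... x_n)^(p-1) has an exponent smaller than p-1, so that its product with
   any p-th power is a derivative and is killed by the Cartier operator; only
   (s0 x_1 ... x_n)^(p-1) contributes to the near-splitting of sigma. *)

(** * Alternating multilinear functions *)

Lemma adjacent_increasing m q (phi : 'I_m -> 'I_q) :
  (forall i j : 'I_m, j = i.+1 :> nat -> (phi i < phi j)%N) ->
  forall i j : 'I_m, (i < j)%N -> (phi i < phi j)%N.
Proof.
move=> phiS i j; elim: {j}_.+1 {-2}j (ltnSn j) => // b IHb j; rewrite ltnS => le_j_b lt_ij.
have j'm : (j.-1 < m)%N by apply: leq_ltn_trans (leq_pred j) (ltn_ord j).
have jE : j = (Ordinal j'm).+1 :> nat by rewrite /=; lia.
have [eq_ij|ne_ij] := eqVneq (i : nat) j.-1.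
  by apply: phiS; rewrite eq_ij -jE.
apply: (ltn_trans _ (phiS _ _ jE)); apply: IHb => /=; lia.
Qed.

Lemma increasing_ge m q (phi : 'I_m -> 'I_q) :
  (forall i j : 'I_m, (i < j)%N -> (phi i < phi j)%N) ->
  forall i : 'I_m, (i <= phi i)%N.
Proof.
move=> phi_incr [i i_m] /=; elim: i i_m => // i IHi i_m.
exact: leq_ltn_trans (IHi (ltnW i_m)) (phi_incr (Ordinal (ltnW i_m)) (Ordinal i_m) (ltnSn i)).
Qed.

(** Conjugating by [rev_ord] turns the lower bound of [increasing_ge] into this upper bound. When
    [m = q] the two bounds make an increasing map the identity. *)
Lemma increasing_le m q (phi : 'I_m -> 'I_q) :
  (forall i j : 'I_m, (i < j)%N -> (phi i < phi j)%N) ->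
  forall i : 'I_m, (phi i + m <= i + q)%N.
Proof.
move=> phi_incr i.
have rev_incr (j1 j2 : 'I_m) :
    (j1 < j2)%N -> (rev_ord (phi (rev_ord j1)) < rev_ord (phi (rev_ord j2)))%N.
  move=> lt_j /=; have /= := phi_incr (rev_ord j2) (rev_ord j1).
  have := ltn_ord j1; have := ltn_ord j2.
  have := ltn_ord (phi (rev_ord j1)); have := ltn_ord (phi (rev_ord j2)); lia.
have := increasing_ge (phi := fun j => rev_ord (phi (rev_ord j))) rev_incr (rev_ord i).
by rewrite rev_ordK /=; have := ltn_ord (phi i); have := ltn_ord i; lia.
Qed.

(** No value lies strictly between [v] and [w], so exchanging them can only reverse the order of the
    pair [(v, w)] itself. *)
Lemma tperm_adjacent_lt m (v w x y : 'I_m) : w = v.+1 :> nat ->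
  (x < y)%N -> ~~ ((x == v) && (y == w)) -> (tperm v w x < tperm v w y)%N.
Proof.
move=> wE lt_xy; rewrite !permE /= -!val_eqE /=.
by do !case: ifP => /=; lia.
Qed.

(** Reindexing by [h] turns the sum into its opposite. Dividing by 2 also takes care of fixed points
    of [h]. *)
Lemma natr2_sum_involution (I : finType) (R : idomainType) (D : pred I)
    (h : I -> I) (t : I -> R) : (2%:R : R) != 0 ->
  (forall i, D i -> [/\ D (h i), h (h i) = i & t (h i) = - t i]) ->
  \sum_(i | D i) t i = 0.
Proof.
move=> two_neq0 hP.
have sumN : \sum_(i | D i) t i = - \sum_(i | D i) t i.
  rewrite {1}(reindex_onto h h) => [|i /hP[]//].
  rewrite -sumrN; apply: eq_big => [i|i /andP[Dhi /eqP hhi]].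
    apply/andP/idP => [[Dhi /eqP <-]|Di]; first by have [] := hP _ Dhi.
    by have [-> -> _] := hP _ Di.
  by have [_ _] := hP _ Dhi; rewrite hhi => ->; rewrite opprK.
apply/eqP; have /eqP := sumN; rewrite -subr_eq0 opprK -mulr2n -mulr_natl mulf_eq0.
by rewrite (negPf two_neq0).
Qed.

Definition setarg m T (a : 'I_m -> T) i v := fun j => if j == i then v else a j.

Lemma setarg_id m T (a : 'I_m -> T) i : setarg a i (a i) = a.
Proof. by apply: functional_extensionality => j; rewrite /setarg; case: eqP => [->|]. Qed.

Section Alternating.
Variables (R : comNzRingType) (q m : nat).
Local Notation V := 'rV[R]_q.

(** Alternation is asked for neighbouring arguments only: this is what sorting needs, and what can
    be checked directly on pairings and shuffles. *)
Record multialt (F : ('I_m -> V) -> R) : Prop := MultiAlt {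
  multialtP : forall a i c u v, F (setarg a i (c *: u + v)) =
    c * F (setarg a i u) + F (setarg a i v);
  multialt_adj : forall a (i j : 'I_m), j = i.+1 :> nat -> a i = a j -> F a = 0
}.

Variables (F : ('I_m -> V) -> R) (F_ma : multialt F).

Lemma multialtD a i u v :
  F (setarg a i (u + v)) = F (setarg a i u) + F (setarg a i v).
Proof. by rewrite -{1}[u]scale1r multialtP // mul1r. Qed.

Lemma multialt0 a i : F (setarg a i 0) = 0.
Proof. by apply: (addrI (F (setarg a i 0))); rewrite -multialtD !addr0. Qed.

Lemma multialt_sum a i (I : Type) (r : seq I) (c : I -> R) (u : I -> V) :
  F (setarg a i (\sum_(x <- r) c x *: u x)) = \sum_(x <- r) c x * F (setarg a i (u x)).
Proof.
elim: r => [|x r IHr]; first by rewrite !big_nil multialt0.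
by rewrite !big_cons multialtP // IHr.
Qed.

(** Polarisation: expand the value 0 of [F] with [a i + a j] in both slots. *)
Lemma multialt_swap a (i j : 'I_m) : j = i.+1 :> nat ->
  F (fun l => a (tperm i j l)) = - F a.
Proof.
move=> jE; have ne_ij : i != j by apply/eqP => ij; move: jE; rewrite ij; lia.
pose b u v := setarg (setarg a i u) j v.
have bC u v : b u v = setarg (setarg a j v) i u.
  by apply: functional_extensionality => l; rewrite /b /setarg; have [->|//] := eqVneq l i;
    rewrite (negPf ne_ij).
have Fb u : F (b u u) = 0.
  by apply: (multialt_adj F_ma jE); rewrite /b /setarg eqxx (negPf ne_ij) eqxx.
have := Fb (a i + a j); rewrite {1}/b multialtD -!/(b _ _) !bC !multialtD -!bC !Fb.
rewrite add0r addr0 => /eqP; rewrite addr_eq0 => /eqP.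
have -> : b (a i) (a j) = a by rewrite /b setarg_id setarg_id.
suff -> : b (a j) (a i) = fun l => a (tperm i j l) by move=> ->.
apply: functional_extensionality => l; rewrite /b /setarg permE /=.
by have [->|_] := eqVneq l i; [rewrite (negPf ne_ij) | case: eqP].
Qed.

(* Bubble sort: exchanging adjacent inverted values increases sum_l l phi(l). *)
Lemma multialt_basis_eq0 :
  (forall phi : 'I_m -> 'I_q, (forall i j : 'I_m, (i < j)%N -> (phi i < phi j)%N) ->
     F (fun i => 'e_(phi i)) = 0) ->
  forall phi : 'I_m -> 'I_q, F (fun i => 'e_(phi i)) = 0.
Proof.
move=> F0 phi; pose mu (f : 'I_m -> 'I_q) := (\sum_(l < m) l * f l)%N.
have mu_le f : (mu f <= \sum_(l < m) m * q)%N.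
  by apply: leq_sum => l _; rewrite leq_mul // ltnW.
elim: {phi}_.+1 {-2}phi (ltnSn (\sum_(l < m) m * q - mu phi)) => // b IHb phi.
rewrite ltnS => mu_b.
case: (pickP [pred ij : 'I_m * 'I_m | (ij.2 == ij.1.+1 :> nat) && (phi ij.2 <= phi ij.1)%N]).
  move=> [i j] /= /andP[/eqP jE]; rewrite leq_eqVlt => /orP[/eqP eq_phi|lt_phi].
    by apply: (multialt_adj F_ma jE); rewrite (val_inj eq_phi).
  apply/eqP; rewrite -oppr_eq0 -(multialt_swap _ jE); apply/eqP.
  apply: (IHb (fun l => phi (tperm i j l))).
  suff : (mu phi < mu (fun l => phi (tperm i j l)))%N.
    by have := mu_le (fun l => phi (tperm i j l)); have := mu_le phi; lia.
  have ne_ji : j != i by apply/eqP => ij; move: jE; rewrite ij; lia.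
  rewrite /mu (bigD1 i) // (bigD1 j) //= [X in (_ < X)%N](bigD1 i) // (bigD1 j) //=.
  rewrite tpermL tpermR !addnA.
  rewrite [X in (_ < _ + X)%N](eq_bigr (fun l : 'I_m => (l * phi l)%N)); last first.
    by move=> l /andP[li lj]; rewrite tpermD // eq_sym.
  by rewrite ltn_add2r jE; nia.
move=> no_inv; apply: F0; apply: adjacent_increasing => i j jE.
by have := no_inv (i, j); rewrite /= jE eqxx /= => /negbT; rewrite -ltnNge.
Qed.

(** The arguments are expanded in the standard basis one slot at a time; in the induction all slots
    from [k] on already hold basis vectors. *)
Lemma multialt_eq0 :
  (forall phi : 'I_m -> 'I_q, (forall i j : 'I_m, (i < j)%N -> (phi i < phi j)%N) ->
     F (fun i => 'e_(phi i)) = 0) ->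
  forall a, F a = 0.
Proof.
move=> /multialt_basis_eq0 F0.
suff Fk k a : (forall i : 'I_m, (k <= i)%N -> exists j, a i = 'e_j) -> F a = 0.
  by move=> a; apply: (Fk m) => i; rewrite leqNgt ltn_ord.
elim: k a => [|k IHk] a ha.
  have /fin_all_exists[phi a_phi] : forall i, exists j, a i = 'e_j by move=> i; apply: ha.
  by rewrite (functional_extensionality _ _ a_phi).
have [k_m|m_k] := ltnP k m; last first.
  by apply: IHk => i; rewrite leqNgt (leq_trans (ltn_ord i)).
rewrite -(setarg_id a (Ordinal k_m)) (row_sum_delta (a _)) multialt_sum big1 // => j _.
rewrite IHk ?mulr0 // => i; rewrite /setarg -val_eqE /= leq_eqVlt eq_sym.
by case: eqP => /= [_ _|_ lt_ki]; [exists j | apply: ha].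
Qed.

End Alternating.

(** * Pairings, shuffles and their signed sums *)

Lemma pair_fst_inj r : injective (@pair_fst r).
Proof. by move=> i j /(congr1 val) /double_inj/val_inj. Qed.

Lemma pair_snd_inj r : injective (@pair_snd r).
Proof. by move=> i j /(congr1 val) /succn_inj/double_inj/val_inj. Qed.

Lemma pair_fst_neq_snd r (i j : 'I_r) : pair_fst i != pair_snd j.
Proof. by rewrite -val_eqE /=; lia. Qed.

Variant pair_spec r : 'I_r.*2 -> Prop :=
  | PairFst i : pair_spec (pair_fst i)
  | PairSnd i : pair_spec (pair_snd i).

Lemma pairP r (x : 'I_r.*2) : pair_spec x.
Proof.
have half_lt : (x./2 < r)%N by have := ltn_ord x; lia.
have [odd_x|even_x] := boolP (odd x).
  have -> : x = pair_snd (Ordinal half_lt) by apply: val_inj => /=; lia.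
  by constructor.
have -> : x = pair_fst (Ordinal half_lt) by apply: val_inj => /=; lia.
by constructor.
Qed.

Lemma big_pair (R : Type) (idx : R) (op : Monoid.com_law idx) r (f : 'I_r.*2 -> R) :
  \big[op/idx]_i f i = \big[op/idx]_i op (f (pair_fst i)) (f (pair_snd i)).
Proof.
rewrite (bigID (fun i : 'I_r.*2 => odd i)) /= Monoid.mulmC big_split /=; congr (op _ _).
  rewrite -big_filter -[RHS](big_map (@pair_fst r) xpredT); apply: perm_big.
  apply: uniq_perm; rewrite ?filter_uniq ?index_enum_uniq //.
    by rewrite map_inj_uniq ?index_enum_uniq //; apply: pair_fst_inj.
  move=> x; rewrite mem_filter mem_index_enum andbT.
  apply/idP/mapP => [|[i _ ->]] /=; last by rewrite odd_double.
  by case: (pairP x) => i /=; rewrite ?odd_double // => _; exists i; rewrite ?mem_index_enum.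
rewrite -big_filter -[RHS](big_map (@pair_snd r) xpredT); apply: perm_big.
apply: uniq_perm; rewrite ?filter_uniq ?index_enum_uniq //.
  by rewrite map_inj_uniq ?index_enum_uniq //; apply: pair_snd_inj.
move=> x; rewrite mem_filter mem_index_enum andbT.
apply/idP/mapP => [|[i _ ->]] /=; last by rewrite odd_double.
by case: (pairP x) => i /=; rewrite ?odd_double // => _; exists i; rewrite ?mem_index_enum.
Qed.

Definition pair_flip r (x : 'I_r.*2) : 'I_r.*2 :=
  let i := Ordinal (etrans (ltn_half_double x r) (ltn_ord x)) in
  if odd x then pair_fst i else pair_snd i.

Lemma pair_flip_fst r (i : 'I_r) : pair_flip (pair_fst i) = pair_snd i.
Proof. by apply: val_inj; rewrite /pair_flip /= odd_double /= doubleK. Qed.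

Lemma pair_flip_snd r (i : 'I_r) : pair_flip (pair_snd i) = pair_fst i.
Proof. by apply: val_inj; rewrite /pair_flip /= odd_double /= uphalf_double. Qed.

Lemma pair_flipK r : involutive (@pair_flip r).
Proof. by move=> x; case: (pairP x) => i; rewrite !(pair_flip_fst, pair_flip_snd). Qed.

Lemma odd_pair_flip r (x : 'I_r.*2) : odd (pair_flip x) = ~~ odd x.
Proof.
by case: (pairP x) => i; rewrite ?pair_flip_fst ?pair_flip_snd /= odd_double.
Qed.

Lemma pairing_permP r (s : 'S_r.*2) :
  reflect ((forall i j : 'I_r, (i < j)%N -> (s (pair_fst i) < s (pair_fst j))%N) /\
           (forall i, (s (pair_fst i) < s (pair_snd i))%N)) (pairing_perm s).
Proof.
apply: (iffP andP) => [[/forallP incr /forallP pair]|[incr pair]]; split => //.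
- by move=> i j; have /forallP/(_ j)/implyP := incr i.
- by do 2?[apply/forallP => ?]; apply/implyP; apply: incr.
- exact/forallP.
Qed.

Lemma shuffleP m l (s : 'S_(m + l)) :
  reflect ((forall i j : 'I_m, (i < j)%N -> (s (lshift l i) < s (lshift l j))%N) /\
           (forall i j : 'I_l, (i < j)%N -> (s (rshift m i) < s (rshift m j))%N)) (shuffle s).
Proof.
apply: (iffP andP) => [[/forallP incrl /forallP incrr]|[incrl incrr]]; split.
- by move=> i j; have /forallP/(_ j)/implyP := incrl i.
- by move=> i j; have /forallP/(_ j)/implyP := incrr i.
- by do 2?[apply/forallP => ?]; apply/implyP; apply: incrl.
- by do 2?[apply/forallP => ?]; apply/implyP; apply: incrr.
Qed.

(* [bivector_pow] and [mv_wedge] for arguments of any type: below these are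
   vectors, basis indices or functions. *)
Definition pfaffian_sum (T : Type) (R : comNzRingType) r (B : T -> T -> R)
    (a : 'I_r.*2 -> T) : R :=
  \sum_(s : 'S_r.*2 | pairing_perm s)
    (-1) ^+ s * \prod_(i < r) B (a (s (pair_fst i))) (a (s (pair_snd i))).

Definition shuffle_wedge (T : Type) (R : comNzRingType) m l
    (P : ('I_m -> T) -> R) (Q : ('I_l -> T) -> R) (a : 'I_(m + l) -> T) : R :=
  \sum_(s : 'S_(m + l) | shuffle s)
    (-1) ^+ s * (P (fun i => a (s (lshift l i))) * Q (fun j => a (s (rshift m j)))).

Section PairingSwap.
Variables (r : nat) (v w : 'I_r.*2).
Hypothesis wE : w = v.+1 :> nat.

(** [swap] is a sign-reversing involution on the pairings in [D], those that do not pair [v] with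
    [w]. Normally it exchanges the values [v] and [w]. If both are first members of their pairs,
    this would spoil the order of the first members, so their partners are exchanged instead. *)
Let firsts (s : 'S_r.*2) := ~~ odd ((s^-1)%g v) && ~~ odd ((s^-1)%g w).

Let swap (s : 'S_r.*2) : 'S_r.*2 :=
  if firsts s then (tperm (pair_flip ((s^-1)%g v)) (pair_flip ((s^-1)%g w)) * s)%g
  else (s * tperm v w)%g.

Let D (s : 'S_r.*2) := pairing_perm s && (pair_flip ((s^-1)%g v) != (s^-1)%g w).

Let neq_vw : v != w. Proof. by rewrite -val_eqE /= wE; lia. Qed.

Lemma pairing_swap (T : Type) (R : comNzRingType) (B : T -> T -> R)
    (a : 'I_r.*2 -> T) (t := fun s : 'S_r.*2 =>
      (-1) ^+ s * \prod_(i < r) B (a (s (pair_fst i))) (a (s (pair_snd i)))) s :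
  a v = a w -> D s -> [/\ D (swap s), swap (swap s) = s & t (swap s) = - t s].
Proof.
move=> a_vw /andP[/pairing_permP[incr pair] ne_flip].
have [F|F] := boolP (firsts s).
  have [i iE] : exists i, (s^-1)%g v = pair_fst i.
    by move: F; rewrite /firsts; case: (pairP ((s^-1)%g v)) => i /=;
      [exists i | rewrite odd_double].
  have [j jE] : exists j, (s^-1)%g w = pair_fst j.
    by move: F; rewrite /firsts andbC; case: (pairP ((s^-1)%g w)) => j /=;
      [exists j | rewrite odd_double].
  have vE : s (pair_fst i) = v by rewrite -iE permKV.
  have wE' : s (pair_fst j) = w by rewrite -jE permKV.
  have ne_ij : i != j by apply: contraNneq neq_vw => ij; rewrite -vE -wE' ij.
  have -> : swap s = (tperm (pair_snd i) (pair_snd j) * s)%g.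
    by rewrite /swap F iE jE !pair_flip_fst.
  set s' := (tperm _ _ * s)%g.
  have s'_fst l : s' (pair_fst l) = s (pair_fst l).
    by rewrite permM tpermD // eq_sym pair_fst_neq_snd.
  have s'_snd l : s' (pair_snd l) = s (pair_snd (tperm i j l)).
    by rewrite permM -(inj_tperm _ _ _ (@pair_snd_inj r)).
  have s'Vv : (s'^-1)%g v = pair_fst i by apply: (perm_inj (s := s')); rewrite permKV s'_fst.
  have s'Vw : (s'^-1)%g w = pair_fst j by apply: (perm_inj (s := s')); rewrite permKV s'_fst.
  have F' : firsts s' by rewrite /firsts s'Vv s'Vw /= !odd_double.
  split.
  - rewrite /D s'Vv s'Vw pair_flip_fst eq_sym pair_fst_neq_snd andbT.
    apply/pairing_permP; split => [l1 l2|l]; first by rewrite !s'_fst; apply: incr.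
    rewrite s'_fst s'_snd; case: tpermP => [->|->|_ _]; last exact: pair.
      (* The new partner of [v] was the partner of [w], hence exceeds [w] and [v]. The new partner
         of [w] was the partner of [v]; it exceeds [v] and is not [w = v + 1], which is a first
         member, so it exceeds [w]. *)
      by rewrite vE; apply: leq_trans (pair j); rewrite wE' wE leqnSn.
    have := pair i; rewrite vE wE' wE leq_eqVlt => /orP[/eqP|//] eq_w.
    have := pair_fst_neq_snd j i; rewrite -(inj_eq (@perm_inj _ s)) wE' -val_eqE /= wE eq_w.
    by rewrite eqxx.
  - by rewrite /swap F' s'Vv s'Vw !pair_flip_fst mulgA tperm2 mul1g.
  - rewrite /t /s' odd_mul_tperm (inj_eq (@pair_snd_inj r)) ne_ij addTb signrN.
    rewrite mulNr; congr (- (_ * _)); rewrite -/s'.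
    (* After exchanging the pairs [i] and [j], the products differ only in first arguments [a v] and
       [a w], which are equal. *)
    rewrite [RHS](reindex_inj (@perm_inj _ (tperm i j))) /=; apply: eq_bigr => l _.
    rewrite s'_fst s'_snd; congr (B _ _).
    by case: tpermP => [->|->|//]; rewrite vE wE'.
have -> : swap s = (s * tperm v w)%g by rewrite /swap (negPf F).
set s' := (s * _)%g.
have s'V x : (s'^-1)%g x = (s^-1)%g (tperm v w x) by rewrite invMg tpermV permM.
have F' : ~~ firsts s' by rewrite /firsts !s'V tpermL tpermR andbC.
split.
- rewrite /D !s'V tpermL tpermR (can2_eq (@pair_flipK r) (@pair_flipK r)) eq_sym ne_flip andbT.
  (* Each required inequality survives the exchange unless it compares [v] with [w]: two first
     members are excluded by [F], the two members of one pair by [ne_flip]. *)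
  apply/pairing_permP; split => [l1 l2 lt_l|l]; rewrite !permM; apply: tperm_adjacent_lt => //.
  - exact: incr.
  - apply: contra F => /andP[/eqP vE /eqP wE'].
    by rewrite /firsts -vE -wE' !permK /= !odd_double.
  - apply: contra ne_flip => /andP[/eqP <- /eqP <-].
    by rewrite !permK pair_flip_fst.
- by rewrite /swap (negPf F') -mulgA tperm2 mulg1.
- rewrite /t /s' odd_permM odd_tperm neq_vw addbT signrN mulNr.
  congr (- (_ * _)); apply: eq_bigr => l _; rewrite !permM.
  by congr (B _ _); case: tpermP => [->|->|].
Qed.

(** The pairings that match [v] with [w] contribute a factor [B x x = 0]; the others cancel under
    [swap]. *)
Lemma pfaffian_sum_adj (T : Type) (R : idomainType) (B : T -> T -> R) (a : 'I_r.*2 -> T) :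
  (2%:R : R) != 0 -> (forall x, B x x = 0) -> a v = a w -> pfaffian_sum B a = 0.
Proof.
move=> two_neq0 B_alt a_vw; rewrite /pfaffian_sum.
rewrite (bigID (fun s : 'S_r.*2 => pair_flip ((s^-1)%g v) != (s^-1)%g w)) /=.
rewrite (natr2_sum_involution (h := swap)) ?add0r //; last first.
  by move=> s /pairing_swap-/(_ _ _ _ _ a_vw); apply.
apply: big1 => s /andP[_ /negPn/eqP flip_v].
have [[i iE]|[i iE]] : (exists i, (s^-1)%g v = pair_fst i) \/ (exists i, (s^-1)%g v = pair_snd i).
- by case: (pairP ((s^-1)%g v)) => i; [left|right]; exists i.
- rewrite (bigD1 i) //= -pair_flip_fst -iE flip_v !permKV a_vw B_alt mul0r mulr0 //.
- rewrite (bigD1 i) //= -pair_flip_snd -iE flip_v !permKV a_vw B_alt mul0r mulr0 //.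
Qed.

End PairingSwap.

(** Each argument enters exactly one factor of each product, as its left or its right entry, whence
    linearity. *)
Lemma pfaffian_sum_multialt (R : idomainType) q r (B : 'rV[R]_q -> 'rV[R]_q -> R) :
  (2%:R : R) != 0 -> (forall x, B x x = 0) ->
  (forall c x y z, B (c *: x + y) z = c * B x z + B y z) ->
  (forall c x y z, B z (c *: x + y) = c * B z x + B z y) ->
  multialt (pfaffian_sum (r := r) B).
Proof.
move=> two_neq0 B_alt B_l B_r; split=> [a x c u v|a i j jE a_ij]; last first.
  exact: (pfaffian_sum_adj jE).
rewrite /pfaffian_sum mulr_sumr -big_split /=; apply: eq_bigr => s _.
rewrite [c * _]mulrCA -mulrDr; congr (_ * _).
have sE y : (s y == x) = (y == (s^-1)%g x) by rewrite (can2_eq (permK s) (permKV s)).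
have off (w : 'rV[R]_q) y : y != (s^-1)%g x -> setarg a x w (s y) = a (s y).
  by rewrite /setarg sE => /negPf ->.
have on w : setarg a x w (s ((s^-1)%g x)) = w by rewrite permKV /setarg eqxx.
have [[i iE]|[i iE]] : (exists i, (s^-1)%g x = pair_fst i) \/ (exists i, (s^-1)%g x = pair_snd i).
  by case: (pairP ((s^-1)%g x)) => i; [left|right]; exists i.
  have ne_i : pair_snd i != (s^-1)%g x by rewrite iE eq_sym pair_fst_neq_snd.
  rewrite !(bigD1 i (P := xpredT)) //= -iE !on !(off _ (pair_snd i) ne_i).
  rewrite B_l mulrDl mulrA; congr (_ * _ + _ * _); apply: eq_bigr => l ne_li;
    rewrite !off // iE ?(inj_eq (@pair_fst_inj r)) // eq_sym pair_fst_neq_snd //.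
have ne_i : pair_fst i != (s^-1)%g x by rewrite iE pair_fst_neq_snd.
rewrite !(bigD1 i (P := xpredT)) //= -iE !on !(off _ (pair_fst i) ne_i).
rewrite B_r mulrDl mulrA; congr (_ * _ + _ * _); apply: eq_bigr => l ne_li;
  rewrite !off // iE ?(inj_eq (@pair_snd_inj r)) // pair_fst_neq_snd //.
Qed.

(** Shuffles that send [x] and [y] to different factors cancel in pairs, by exchanging these two
    values. In the remaining ones [x] and [y] are neighbouring arguments of [P] or of [Q], which
    then vanishes. *)
Lemma shuffle_wedge_multialt (R : idomainType) q m l
    (P : ('I_m -> 'rV[R]_q) -> R) (Q : ('I_l -> 'rV[R]_q) -> R) :
  (2%:R : R) != 0 -> multialt P -> multialt Q -> multialt (shuffle_wedge P Q).
Proof.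
move=> two_neq0 Pma Qma; split=> [a x c u v|a x y yE a_xy].
  rewrite /shuffle_wedge mulr_sumr -big_split /=; apply: eq_bigr => s _.
  rewrite [c * _]mulrCA -mulrDr; congr (_ * _).
  have sE y : (s y == x) = (y == (s^-1)%g x) by rewrite (can2_eq (permK s) (permKV s)).
  case: (splitP ((s^-1)%g x)) => i iE.
    have Pset w : P (fun j => setarg a x w (s (lshift l j))) =
        P (setarg (fun j => a (s (lshift l j))) i w).
      by congr P; apply: functional_extensionality => j; rewrite /setarg sE -!val_eqE /= iE.
    have Qset w : (fun j => setarg a x w (s (rshift m j))) = fun j => a (s (rshift m j)).
      apply: functional_extensionality => j; rewrite /setarg sE -val_eqE /= iE.
      by case: eqP => //; have := ltn_ord i; lia.
    by rewrite !Pset !Qset (multialtP Pma) mulrDl mulrA.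
  have Qset w : Q (fun j => setarg a x w (s (rshift m j))) =
      Q (setarg (fun j => a (s (rshift m j))) i w).
    by congr Q; apply: functional_extensionality => j; rewrite /setarg sE -!val_eqE /= iE eqn_add2l.
  have Pset w : (fun j => setarg a x w (s (lshift l j))) = fun j => a (s (lshift l j)).
    apply: functional_extensionality => j; rewrite /setarg sE -val_eqE /= iE.
    by case: eqP => //; have := ltn_ord j; lia.
  by rewrite !Qset !Pset (multialtP Qma) mulrDr mulrCA.
have ne_xy : x != y by rewrite -val_eqE /= yE; lia.
rewrite /shuffle_wedge.
rewrite (bigID (fun s : 'S_(m + l) => ((s^-1)%g x < m)%N != ((s^-1)%g y < m)%N)) /=.
rewrite (natr2_sum_involution (h := fun s => (s * tperm x y)%g)) ?add0r //; last first.
  move=> s /andP[/shuffleP[incrl incrr] ne_side]; split.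
  - rewrite !invMg !tpermV !permM tpermL tpermR eq_sym ne_side andbT.
    apply/shuffleP; split=> i j lt_ij; rewrite !permM; apply: tperm_adjacent_lt => //.
    + exact: incrl.
    + apply: contra ne_side => /andP[/eqP <- /eqP <-].
      by rewrite !permK /= !ltn_ord.
    + exact: incrr.
    + apply: contra ne_side => /andP[/eqP <- /eqP <-].
      by rewrite !permK /= !ltnNge !leq_addr.
  - by rewrite -mulgA tperm2 mulg1.
  - rewrite odd_permM odd_tperm ne_xy addbT signrN mulNr.
    congr (- (_ * (P _ * Q _))); apply: functional_extensionality => j;
      by rewrite permM; case: tpermP => [->|->|].
apply: big1 => s /andP[/shuffleP[incrl incrr] /negPn/eqP same_side].
(* An increasing map takes consecutive values at consecutive positions: a position in between would
   have a value in between. *)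
have mon n0 (f : 'I_n0 -> 'I_(m + l)) (i j : 'I_n0) : (forall i j : 'I_n0, (i < j)%N ->
  (f i < f j)%N) ->
    f i = x -> f j = y -> j = i.+1 :> nat.
  move=> f_incr fi fj; have lt_ij : (i < j)%N.
    rewrite ltnNge leq_eqVlt; apply/negP => /orP[/eqP/val_inj ji|/f_incr].
      by move: ne_xy; rewrite -fi -fj ji eqxx.
    by rewrite fi fj yE; lia.
  apply/eqP; rewrite eqn_leq lt_ij andbT leqNgt; apply/negP => lt_Sij.
  have i'_lt : (i.+1 < n0)%N by apply: ltn_trans (ltn_ord j).
  have := f_incr i (Ordinal i'_lt) (ltnSn i).
  have := f_incr (Ordinal i'_lt) j lt_Sij; rewrite fi fj yE; lia.
case: (splitP ((s^-1)%g x)) => i iE; move: same_side; rewrite iE.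
  rewrite ltn_ord => /esym y_lt.
  have sx : s (lshift l i) = x by rewrite -(permKV s x); congr (s _); apply: val_inj; rewrite /= iE.
  have sy : s (lshift l (Ordinal y_lt)) = y by rewrite -[RHS](permKV s y); congr (s _);
    apply: val_inj.
  rewrite (multialt_adj Pma (mon _ _ _ _ incrl sx sy)) ?mul0r ?mulr0 //.
  by rewrite sx sy.
rewrite ltnNge leq_addr /= => /esym/negbT; rewrite -leqNgt => y_ge.
have y_lt : ((s^-1)%g y - m < l)%N by have := ltn_ord ((s^-1)%g y); lia.
have sx : s (rshift m i) = x by rewrite -(permKV s x); congr (s _); apply: val_inj; rewrite /= iE.
have sy : s (rshift m (Ordinal y_lt)) = y.
  by rewrite -[RHS](permKV s y); congr (s _); apply: val_inj => /=; lia.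
rewrite (multialt_adj Qma (mon _ _ _ _ incrr sx sy)) ?mulr0 //.
by rewrite sx sy.
Qed.

Lemma det_multialt (R : comNzRingType) q l (g : 'I_l -> 'rV[R]_q -> R) :
  (forall i c x y, g i (c *: x + y) = c * g i x + g i y) ->
  multialt (fun a : 'I_l -> 'rV[R]_q => \det (\matrix_(i, j) g i (a j))).
Proof.
move=> g_lin.
have detT a : \det (\matrix_(i, j) g i (a j)) = \det (\matrix_(j, i) g i (a j)).
  by rewrite -det_tr; congr (\det _); apply/matrixP => i j; rewrite !mxE.
split=> [a x c u v|a x y yE a_xy]; rewrite !detT.
  rewrite -[X in _ = _ + X]mul1r; apply: (determinant_multilinear (i0 := x)).
  - by apply/rowP => j; rewrite !mxE /setarg eqxx g_lin mul1r.
  - by apply/matrixP => i j; rewrite !mxE /setarg eq_sym (negPf (neq_lift _ _)).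
  - by apply/matrixP => i j; rewrite !mxE /setarg eq_sym (negPf (neq_lift _ _)).
apply: (determinant_alternate (i1 := x) (i2 := y)).
  by rewrite -val_eqE /= yE; lia.
by move=> j; rewrite !mxE a_xy.
Qed.

(** * Symplectic bases *)

Lemma pfaffian_sum_radical (T : Type) (R : comNzRingType) r (B : T -> T -> R)
    (a : 'I_r.*2 -> T) x :
  (forall y, B (a x) y = 0) -> (forall y, B y (a x) = 0) -> pfaffian_sum B a = 0.
Proof.
move=> Bl Br; apply: big1 => s _; have := permKV s x.
case: (pairP ((s^-1)%g x)) => i sx.
  by rewrite (bigD1 i) //= sx Bl mul0r mulr0.
by rewrite (bigD1 i) //= sx Br mul0r mulr0.
Qed.

Section MxForm.
Variables (R : comNzRingType) (q : nat) (L : 'M[R]_q).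

Definition mxform (x y : 'rV[R]_q) : R := (x *m L *m y^T) 0 0.

Lemma mxform_linearl c x y z : mxform (c *: x + y) z = c * mxform x z + mxform y z.
Proof. by rewrite /mxform !mulmxDl -!scalemxAl !mxE. Qed.

Lemma mxform_linearr c x y z : mxform z (c *: x + y) = c * mxform z x + mxform z y.
Proof. by rewrite /mxform linearP /= mulmxDr -scalemxAr !mxE. Qed.

Lemma mxform_delta i j : mxform 'e_i 'e_j = L i j.
Proof. by rewrite /mxform -rowE trmx_delta -colE !mxE. Qed.

Lemma mxform_row m1 m2 (U1 : 'M[R]_(m1, q)) (U2 : 'M[R]_(m2, q)) i j :
  mxform (row i U1) (row j U2) = (U1 *m L *m U2^T) i j.
Proof. by rewrite /mxform -row_mul tr_row !mxE; apply: eq_bigr => l _; rewrite !mxE. Qed.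

Lemma mxform_skew : L^T = - L -> forall x y, mxform y x = - mxform x y.
Proof.
move=> L_skew x y; rewrite /mxform; transitivity ((y *m L *m x^T)^T 0 0).
  by rewrite [RHS]mxE.
by rewrite !trmx_mul trmxK L_skew mulNmx mulmxN mulmxA mxE.
Qed.

End MxForm.

Lemma mxform_alt (R : idomainType) q (L : 'M[R]_q) x :
  (2%:R : R) != 0 -> L^T = - L -> mxform L x x = 0.
Proof.
move=> two_neq0 /mxform_skew/(_ x x)/eqP; rewrite -subr_eq0 opprK -mulr2n -mulr_natl.
by rewrite mulf_eq0 (negPf two_neq0) => /eqP.
Qed.

(* The standard symplectic matrix, made of diagonal blocks [[0,1],[-1,0]]. *)
Definition symplectic_entry (R : pzRingType) (i j : nat) : R :=
  if i./2 == j./2 then (odd j)%:R - (odd i)%:R else 0.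

Definition symplectic_mx (R : pzRingType) s : 'M[R]_s.*2 :=
  \matrix_(i, j) symplectic_entry R i j.

Lemma symplectic_mx_tr (R : pzRingType) s : (symplectic_mx R s)^T = - symplectic_mx R s.
Proof.
apply/matrixP => i j; rewrite !mxE /symplectic_entry eq_sym.
by case: eqP; rewrite ?oppr0 // opprB.
Qed.

Lemma symplectic_mx_sqr (R : pzRingType) s : symplectic_mx R s *m symplectic_mx R s = - 1%:M.
Proof.
apply/matrixP => i j; rewrite !mxE big_pair /=.
have half_lt : (i./2 < s)%N by have := ltn_ord i; lia.
rewrite (bigD1 (Ordinal half_lt)) //= big1 ?addr0 => [|l ne_l]; last first.
  rewrite !mxE /symplectic_entry /= doubleK uphalf_double odd_double /=.
  have /negPf -> : i./2 != l by rewrite -val_eqE eq_sym /= in ne_l.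
  by rewrite !mul0r addr0.
rewrite !mxE /symplectic_entry /= !(doubleK, uphalf_double, odd_double) eqxx /=.
rewrite sub0r subr0 -val_eqE /=.
have [eq_half|ne_half] := eqVneq i./2 j./2; last first.
  rewrite !mulr0 addr0; case: eqP => [eq_ij|]; last by rewrite oppr0.
  by rewrite eq_ij eqxx in ne_half.
have -> : (i == j :> nat) = (odd i == odd j).
  by rewrite -{1}(odd_double_half i) -{1}(odd_double_half j) eq_half eqn_add2r;
    case: (odd i) (odd j) => [] [].
by case: (odd i) (odd j) => [] [] /=;
  rewrite ?(sub0r, subr0, subrr, mul0r, mulr0, mul1r, mulr1, addr0, add0r, oppr0, mulrN1).
Qed.

(** Only the identity contributes. A non-zero product forces every pair to be a block
    [(2h, 2h + 1)], and the order of the first members makes the map from pairs to blocks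
    increasing, hence the identity. *)
Lemma pfaffian_sum_symplectic (R : comNzRingType) r :
  pfaffian_sum (r := r) (fun i j : nat => symplectic_entry R i j) (@nat_of_ord _) = 1.
Proof.
rewrite /pfaffian_sum (bigD1 1%g) /=; last first.
  by apply/pairing_permP; split=> [i j|i]; rewrite !perm1 /= ?ltn_double.
rewrite odd_perm1 mul1r (eq_bigr (fun _ => 1)) => [|i _]; last first.
  by rewrite !perm1 /symplectic_entry /= doubleK uphalf_double eqxx odd_double subr0.
rewrite big1 // big1 ?addr0 // => s /andP[/pairing_permP[incr pair] s_neq1].
have [all_nz|] := boolP [forall i : 'I_r,
  symplectic_entry R (s (pair_fst i)) (s (pair_snd i)) != 0];
  last first.
  move=> /forallPn[i /negPn/eqP zi]; rewrite (bigD1 i) //= zi mul0r mulr0 //.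
have half_lt (i : 'I_r) : ((s (pair_fst i))./2 < r)%N by have := ltn_ord (s (pair_fst i)); lia.
have sP i : s (pair_fst i) = (s (pair_fst i))./2.*2 :> nat /\
            s (pair_snd i) = (s (pair_fst i))./2.*2.+1 :> nat.
  move/forallP/(_ i): all_nz; rewrite /symplectic_entry; have := pair i.
  by have [eq_half lt_s _|_ _ /eqP//] := eqVneq (s (pair_fst i))./2 (s (pair_snd i))./2; split; lia.
have half_incr (i j : 'I_r) : (i < j)%N -> (Ordinal (half_lt i) < Ordinal (half_lt j))%N.
  by move=> /incr /=; have [-> _] := sP i; have [-> _] := sP j; rewrite !doubleK ltn_double.
have halfE i : (s (pair_fst i))./2 = i.
  apply/eqP; rewrite eqn_leq (increasing_ge half_incr i) andbT.
  by have := increasing_le half_incr i; rewrite leq_add2r.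
case/eqP: s_neq1; apply/permP => x; rewrite perm1; apply: val_inj.
by case: (pairP x) => i /=; have := sP i; rewrite halfE => -[].
Qed.

Section SymplecticBasis.
Variables (k : fieldType) (n : nat) (L : 'M[k]_n).
Hypothesis L_skew : L^T = - L.
Hypothesis two_neq0 : (2%:R : k) != 0.
Local Notation J := (symplectic_mx k).

(** The family is indexed by [nat], so that it can be lengthened by two vectors without casts. *)
Let symplectic s (u : nat -> 'rV[k]_n) := forall i j, (i < s.*2)%N -> (j < s.*2)%N ->
  mxform L (u i) (u j) = symplectic_entry k i j.

Let span s (u : nat -> 'rV[k]_n) : 'M[k]_(s.*2, n) := \matrix_(i < s.*2) u i.

Lemma symplectic_gram s u : symplectic s u -> span s u *m L *m (span s u)^T = J s.
Proof.
move=> u_sym; apply/matrixP => i j; rewrite [RHS]mxE -u_sym // -mxform_row.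
by rewrite !rowK.
Qed.

(** Gram-Schmidt for skew forms: [x *m Phi] is the projection of [x] to the [L]-orthogonal
    complement of the span of [u]. If [L] vanishes on this complement, then [L] is recovered from
    its pairing with the span; otherwise the complement contains another hyperbolic pair. *)
Lemma symplectic_extend s u : symplectic s u ->
  L = L *m (span s u)^T *m J s *m (L *m (span s u)^T)^T \/ exists v, symplectic s.+1 v.
Proof.
move=> u_sym; have gram := symplectic_gram u_sym.
set U := span s u in gram *; pose Phi := 1%:M + L *m U^T *m J s *m U.
have Phi_orth : Phi *m L *m U^T = 0.
  rewrite !mulmxDl !mul1mx -!mulmxA (mulmxA U) gram symplectic_mx_sqr.
  by rewrite !mulmxN mulmx1 subrr.
have PhiT : Phi^T = 1%:M + U^T *m J s *m U *m L.
  rewrite linearD /= !trmx_mul trmx1 trmxK symplectic_mx_tr L_skew.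
  by rewrite !(mulmxN, mulNmx) opprK !mulmxA.
have [N0|N_neq0] := eqVneq (Phi *m L *m Phi^T) 0; [left|right].
  (* By [Phi_orth], [Phi *m L *m Phi^T] equals [Phi *m L]. *)
  have : Phi *m L = 0.
    by rewrite -N0 PhiT mulmxDr mulmx1 !mulmxA Phi_orth !mul0mx addr0.
  rewrite mulmxDl mul1mx => /eqP; rewrite addr_eq0 => /eqP {1}->.
  by rewrite trmx_mul trmxK L_skew !(mulmxN, mulNmx) !mulmxA.
have /existsP[i /existsP[j Nij]] : [exists i, exists j, (Phi *m L *m Phi^T) i j != 0].
  apply: contra_neqT N_neq0 => /existsPn no_ij; apply/matrixP => i j; rewrite [RHS]mxE.
  by have /existsPn/(_ j)/negPn/eqP := no_ij i.
pose c := (Phi *m L *m Phi^T) i j.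
(* Dividing the second new vector by [c] makes the form equal to 1 on the new pair. *)
pose v l := if l == s.*2 then row i Phi else if l == s.*2.+1 then c^-1 *: row j Phi else u l.
have formZ a x y : mxform L y (a *: x) = a * mxform L y x.
  by rewrite -[a *: x]addr0 mxform_linearr /mxform trmx0 mulmx0 [X in _ + X]mxE addr0.
have orth a l : (l < s.*2)%N -> mxform L (row a Phi) (u l) = 0.
  move=> l_lt; have -> : u l = row (Ordinal l_lt) U by rewrite rowK.
  by rewrite mxform_row Phi_orth mxE.
have v_lt a b : (a < b)%N -> (b < s.+1.*2)%N -> mxform L (v a) (v b) = symplectic_entry k a b.
  move=> lt_ab b_lt; rewrite /v.
  have [bE|b_ne] := eqVneq b s.*2.+1.
    have [aE|a_ne] := eqVneq a s.*2.
      rewrite bE (_ : s.*2.+1 == s.*2 = false); last by lia.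
      rewrite formZ mxform_row mulVf // aE /symplectic_entry /= uphalf_double doubleK.
      by rewrite eqxx odd_double subr0.
    rewrite bE (_ : s.*2.+1 == s.*2 = false); last by lia.
    rewrite (_ : a == s.*2.+1 = false); last by lia.
    rewrite formZ mxform_skew // orth; last by lia.
    rewrite oppr0 mulr0 /symplectic_entry; case: eqP => //; lia.
  have [bE|b_ne'] := eqVneq b s.*2.
    rewrite (_ : a == s.*2 = false); last by lia.
    rewrite (_ : a == s.*2.+1 = false); last by lia.
    rewrite mxform_skew // orth; last by lia.
    rewrite oppr0 /symplectic_entry; case: eqP => //; lia.
  rewrite (_ : a == s.*2 = false); last by lia.
  rewrite (_ : a == s.*2.+1 = false); last by lia.
  by rewrite u_sym //; lia.
exists v => a b a_lt b_lt; have [lt_ab|lt_ba|->] := ltngtP a b; first exact: v_lt.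
  rewrite mxform_skew // v_lt // /symplectic_entry eq_sym.
  by case: eqP; rewrite ?oppr0 // opprB.
by rewrite mxform_alt // /symplectic_entry eqxx subrr.
Qed.

(** The factorisation through [s.*2] columns bounds the rank of [L] from above; the invertible Gram
    matrix [J s] of the family bounds it from below. *)
Lemma symplectic_basis : exists s (u : nat -> 'rV[k]_n) (S : 'M[k]_(n, s.*2)),
  [/\ forall i j, (i < s.*2)%N -> (j < s.*2)%N ->
       mxform L (u i) (u j) = symplectic_entry k i j,
      L = S *m J s *m S^T & \rank L = s.*2].
Proof.
suff [s [u [u_sym L_span]]] : exists s u,
    symplectic s u /\ L = L *m (span s u)^T *m J s *m (L *m (span s u)^T)^T.
  exists s, u, (L *m (span s u)^T); split=> //; apply/eqP; rewrite eqn_leq.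
  rewrite {1}L_span -mulmxA (leq_trans (mxrankM_maxl _ _)) ?rank_leq_col //=.
  have J_unit : J s \in unitmx.
    by have [] := @mulmx1_unit _ _ (J s) (- J s); rewrite // mulmxN symplectic_mx_sqr opprK.
  rewrite -{1}(mxrank_unit J_unit) -(symplectic_gram u_sym) -mulmxA.
  by rewrite (leq_trans (mxrankM_maxr _ _)) // mxrankM_maxl.
(* The extension must stop: the invertible Gram matrix of [n + 1] hyperbolic pairs would give
   [2(n + 1)] independent vectors in dimension [n]. *)
suff step t : (exists u, symplectic t u) \/ exists s u,
    symplectic s u /\ L = L *m (span s u)^T *m J s *m (L *m (span s u)^T)^T.
  have [[u u_sym]|//] := step n.+1.
  have := rank_leq_col (span n.+1 u).
  have J_unit : J n.+1 \in unitmx.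
    by have [] := @mulmx1_unit _ _ (J n.+1) (- J n.+1); rewrite // mulmxN symplectic_mx_sqr opprK.
  have : (n.+1.*2 <= \rank (span n.+1 u))%N.
    rewrite -{1}(mxrank_unit J_unit) -(symplectic_gram u_sym) -mulmxA.
    exact: mxrankM_maxl.
  lia.
elim: t => [|t [[u u_sym]|]]; [by left; exists (fun=> 0) | | by right].
by have [L_span|[v]] := symplectic_extend u_sym; [right; exists t, u | left; exists v].
Qed.

End SymplecticBasis.

(** * The non-vanishing log-canonical coefficient *)

(** On each of the two blocks the shuffle restricts to an increasing self-map, which is the
    identity. *)
Lemma shuffle_lshift_eq1 m l (s : 'S_(m + l)) :
  shuffle s -> (forall i : 'I_m, (s (lshift l i) < m)%N) -> s = 1%g.
Proof.
move=> /shuffleP[incrl incrr] s_left.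
have sl i : s (lshift l i) = lshift l i.
  apply: val_inj => /=; apply/eqP; rewrite eqn_leq.
  have left_incr (i1 i2 : 'I_m) : (i1 < i2)%N -> (Ordinal (s_left i1) < Ordinal (s_left i2))%N.
    exact: incrl.
  have := increasing_le left_incr i; rewrite leq_add2r /= => ->.
  exact: (increasing_ge left_incr i).
have s_right j : (m <= s (rshift m j))%N.
  rewrite leqNgt; apply/negP => lt_m.
  have /perm_inj/(congr1 val) /= : s (lshift l (Ordinal lt_m)) = s (rshift m j).
    by rewrite sl; apply: val_inj.
  by lia.
have s_right_lt j : (s (rshift m j) - m < l)%N.
  by have := ltn_ord (s (rshift m j)); have := s_right j; lia.
have right_incr (i1 i2 : 'I_l) :
    (i1 < i2)%N -> (Ordinal (s_right_lt i1) < Ordinal (s_right_lt i2))%N.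
  by move=> /incrr /=; have := s_right i1; have := s_right i2; lia.
apply/permP => x; rewrite perm1; case: (split_ordP x) => j -> //; apply: val_inj => /=.
have := increasing_le right_incr j; have := increasing_ge right_incr j.
by have := s_right j; rewrite /=; lia.
Qed.

Section Transversal.
Variables (k : fieldType) (n : nat) (L M : 'M[k]_n).
Hypothesis two_neq0 : (2%:R : k) != 0.
Hypothesis L_skew : L^T = - L.
Hypothesis ML : forall i j : 'I_n, (i < j)%N -> L i j = M i j.
Hypothesis M_diag : forall i, M i i != 0.

(* [M - L] is triangular with non-zero diagonal, so the rows of [M] and [L]
   together span, that is, [M] is injective on the kernel of [L]. *)
Lemma radical_dual : exists G, G *m M *m (row_base (kermx L))^T = 1%:M.
Proof.
set B := row_base _.
have BL : B *m L = 0 by apply/sub_kermxP; rewrite eq_row_base.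
suff /row_freeP[D BMD] : row_free (B *m M^T).
  by exists D^T; apply: trmx_inj; rewrite !trmx_mul !trmxK mulmxA BMD trmx1.
apply: inj_row_free => y yBM; apply: (row_free_inj (row_base_free (kermx L))).
rewrite mul0mx -/B.
have trig : is_trig_mx (M - L).
  by apply/is_trig_mxP => i j lt_ij; rewrite !mxE ML // subrr.
have unit_trig : (M - L)^T \in unitmx.
  rewrite unitmx_tr unitmxE det_trig // unitfE prodf_seq_neq0; apply/allP => i _ /=.
  rewrite !mxE; suff -> : L i i = 0 by rewrite subr0.
  rewrite -mxform_delta; exact: mxform_alt.
(* By skew-symmetry [(M - L)^T = M^T + L], and both summands annihilate [y *m B]. *)
rewrite -[y *m B](mulmxK unit_trig) linearB /= L_skew opprK mulmxDr.
by rewrite -mulmxA yBM -mulmxA BL mulmx0 addr0 mul0mx.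
Qed.

(** The displayed sum is the value on the standard basis of a top-degree alternating form [F]. Were
    it zero, [F] would vanish identically; but [F] is 1 on a symplectic family completed by a basis
    of the kernel of [L], with [G] chosen dual to that basis. *)
Lemma transversal_exists : exists s l (e : (s.*2 + l)%N = n) (G : 'M_(l, n)),
  (exists S : 'M_(n, s.*2), L = S *m symplectic_mx k s *m S^T) /\
  shuffle_wedge (pfaffian_sum (r := s) L)
    (fun b : 'I_l -> 'I_n => \det (\matrix_(i, j) (G *m M) i (b j))) (cast_ord e) != 0.
Proof.
have [s [u [S [u_sym L_fact L_rank]]]] := symplectic_basis L_skew two_neq0.
have [G GB] := radical_dual.
move: G GB; set B := row_base _; set l := \rank (kermx L) in B * => G GB.
have e : (s.*2 + l)%N = n.
  by rewrite /l mxrank_ker L_rank subnKC // -L_rank rank_leq_row.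
exists s, l, e, G; split; first by exists S.
pose F := shuffle_wedge (pfaffian_sum (r := s) (mxform L))
  (fun b : 'I_l -> 'rV_n => \det (\matrix_(i, j) (G *m M *m (b j)^T) i 0)).
have F_ma : multialt F.
  apply: shuffle_wedge_multialt => //.
    apply: pfaffian_sum_multialt => //; first by move=> x; apply: mxform_alt.
      by move=> *; apply: mxform_linearl.
    by move=> *; apply: mxform_linearr.
  by apply: (det_multialt (g := fun i x => (G *m M *m x^T) i 0)) => i c x y;
    rewrite linearP /= mulmxDr -scalemxAr !mxE.
have F_delta phi : F (fun i => 'e_(phi i)) =
    shuffle_wedge (pfaffian_sum (r := s) L)
      (fun b : 'I_l -> 'I_n => \det (\matrix_(i, j) (G *m M) i (b j))) phi.
  apply: eq_bigr => x _; congr (_ * (_ * _)).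
    by apply: eq_bigr => y _; congr (_ * _); apply: eq_bigr => i _; rewrite mxform_delta.
  by congr (\det _); apply/matrixP => i j; rewrite [LHS]mxE [RHS]mxE trmx_delta -colE mxE.
rewrite -F_delta; apply/eqP => F0.
pose a x := match split x with inl i => u (i : 'I_s.*2) | inr j => row (j : 'I_l) B end.
have a_l i : a (lshift l i) = u i by rewrite /a (unsplitK (inl i)).
have a_r j : a (rshift s.*2 j) = row j B by rewrite /a (unsplitK (inr j)).
have /eqP : F a = 0.
  (* Since [s.*2 + l = n], the only increasing index map is the cast. *)
  apply: (multialt_eq0 F_ma) => phi phi_incr.
  suff -> : phi = cast_ord e by [].
  apply: functional_extensionality => i; apply: val_inj; apply/eqP => /=.
  rewrite eqn_leq (increasing_ge phi_incr) andbT.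
  by have := increasing_le phi_incr i; clear -e; lia.
apply/negP; rewrite /F /shuffle_wedge (bigD1 1%g) /=; last first.
  by apply/shuffleP; split=> i j; rewrite !perm1 //= ltn_add2l.
rewrite big1 ?addr0 => [|x /andP[x_sh x_neq1]].
  rewrite odd_perm1 mul1r (_ : pfaffian_sum _ _ = 1) ?mul1r.
    rewrite (_ : \matrix_(i, j) _ = 1%:M) ?det1 ?oner_eq0 //; apply/matrixP => i j.
    by rewrite -GB !mxE; apply: eq_bigr => y _; rewrite perm1 a_r !mxE.
  rewrite -[RHS](pfaffian_sum_symplectic k s); apply: eq_bigr => x _; congr (_ * _).
  by apply: eq_bigr => i _; rewrite !perm1 !a_l u_sym.
(* A shuffle other than the identity puts some kernel vector among the arguments of the Pfaffian,
   which is then zero. *)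
case: (pickP [pred i | s.*2 <= x (lshift l i)]%N) => [i /= i_ge|no_i]; last first.
  case/eqP: x_neq1; apply: shuffle_lshift_eq1 => // i.
  by rewrite ltnNge; apply/negPf/no_i.
have [j xi] : exists j, x (lshift l i) = rshift s.*2 j.
  by case: (split_ordP (x (lshift l i))) i_ge => j -> /=; [rewrite leqNgt ltn_ord | exists j].
have BL0 y : mxform L (row j B) y = 0.
  rewrite /mxform -row_mul (_ : B *m L = 0) ?row0 ?mul0mx ?mxE //.
  by apply/sub_kermxP; rewrite eq_row_base.
rewrite (pfaffian_sum_radical (x := i)) ?mul0r ?mulr0 // => y; rewrite xi a_r //.
by rewrite mxform_skew // BL0 oppr0.
Qed.

End Transversal.

(** * Lexicographic leading terms *)

Section LexLead.
Variables (k : fieldType) (n : nat).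
Local Notation A := {mpoly k[n]}.
Implicit Types (m : 'X_{1..n}) (f g : A) (c : k).

(** The witness [i] is what the Cartier argument takes from a comparison: a variable whose exponent
    is smaller in [m1]. *)
Definition lexlt m1 m2 :=
  exists2 i : 'I_n, (m1 i < m2 i)%N & forall j : 'I_n, (j < i)%N -> m1 j = m2 j.

Lemma lexltDl m m1 m2 : lexlt m1 m2 -> lexlt (m + m1)%MM (m + m2)%MM.
Proof.
move=> [i lt_i eq_i]; exists i => [|j lt_ji]; rewrite !mnmDE ?ltn_add2l //.
by rewrite eq_i.
Qed.

Lemma lexltD m1 m2 m1' m2' : lexlt m1 m2 -> lexlt m1' m2' -> lexlt (m1 + m1')%MM (m2 + m2')%MM.
Proof.
move=> [i lt_i eq_i] [i' lt_i' eq_i'].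
have [lt_ii'|lt_i'i|eq_ii'] := ltngtP i i'.
- exists i => [|j lt_ji]; rewrite !mnmDE; first by rewrite eq_i' // ltn_add2r.
  by rewrite eq_i // eq_i' // (ltn_trans lt_ji).
- exists i' => [|j lt_ji]; rewrite !mnmDE; first by rewrite eq_i // ltn_add2l.
  by rewrite eq_i' // eq_i // (ltn_trans lt_ji).
- move: lt_i' eq_i'; rewrite -(val_inj eq_ii') => lt_i' eq_i'.
  exists i => [|j lt_ji]; rewrite !mnmDE; first by rewrite -addSn leq_add // ltnW.
  by rewrite eq_i ?eq_i'.
Qed.

Definition lexlow m g := forall m', m' \in msupp g -> lexlt m' m.

Lemma lexlow0 m : lexlow m 0.
Proof. by move=> m'; rewrite msupp0. Qed.

Lemma lexlowD m f g : lexlow m f -> lexlow m g -> lexlow m (f + g).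
Proof. by move=> hf hg m' /msuppD_le; rewrite mem_cat => /orP[/hf|/hg]. Qed.

Lemma lexlowZ m c g : lexlow m g -> lexlow m (c *: g).
Proof. by move=> hg m' /msuppZ_le/hg. Qed.

Lemma lexlowM m1 m2 f g : lexlow m1 f -> lexlow m2 g -> lexlow (m1 + m2)%MM (f * g).
Proof. by move=> hf hg m' /msuppM_le/allpairsP[[a b] /= [/hf ha /hg hb ->]]; apply: lexltD. Qed.

Lemma lexlowMX m1 m2 g : lexlow m2 g -> lexlow (m1 + m2)%MM ('X_[m1] * g).
Proof.
move=> hg m' /msuppM_le/allpairsP[[a b] /=]; rewrite msuppX inE => -[/eqP -> /hg hb ->].
exact: lexltDl.
Qed.

(** The coefficient [c] may be 0, so that these statements can be added even when leading terms
    cancel. *)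
Definition lexlead m c f := exists2 g, f = c *: 'X_[m] + g & lexlow m g.

Lemma lexlead0 m : lexlead m 0 0.
Proof. by exists 0; [rewrite scale0r addr0 | apply: lexlow0]. Qed.

Lemma lexlead1 : lexlead 0%MM 1 1.
Proof. by exists 0; [rewrite scale1r mpolyX0 addr0 | apply: lexlow0]. Qed.

Lemma lexleadD m c1 c2 f1 f2 :
  lexlead m c1 f1 -> lexlead m c2 f2 -> lexlead m (c1 + c2) (f1 + f2).
Proof.
move=> [g1 -> low1] [g2 -> low2]; exists (g1 + g2); last exact: lexlowD.
by rewrite scalerDl addrACA.
Qed.

Lemma lexleadZ m a c f : lexlead m c f -> lexlead m (a * c) (a *: f).
Proof.
move=> [g -> low_g]; exists (a *: g); last exact: lexlowZ.
by rewrite scalerDr scalerA.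
Qed.

Lemma lexlead_sign m b c f : lexlead m c f -> lexlead m ((-1) ^+ b * c) ((-1) ^+ b * f).
Proof.
move=> lead_f; rewrite -(rmorph_sign (@mpolyC n k)) mul_mpolyC.
exact: lexleadZ.
Qed.

Lemma lexleadM m1 m2 c1 c2 f1 f2 :
  lexlead m1 c1 f1 -> lexlead m2 c2 f2 -> lexlead (m1 + m2)%MM (c1 * c2) (f1 * f2).
Proof.
move=> [g1 -> low1] [g2 -> low2].
exists (c1 *: ('X_[m1] * g2) + c2 *: ('X_[m2] * g1) + g1 * g2).
  rewrite mulrDl !mulrDr mpolyXD -!scalerAl -!scalerAr scalerA -!addrA; congr (_ + _).
  by rewrite [g1 * 'X_[_]]mulrC.
do 2?apply: lexlowD; last exact: lexlowM.
  exact/lexlowZ/lexlowMX.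
by apply: lexlowZ; rewrite addmC; apply: lexlowMX.
Qed.

Lemma lexlead_sum (I : Type) (r : seq I) (P : pred I) m (c : I -> k) (f : I -> A) :
  (forall i, P i -> lexlead m (c i) (f i)) ->
  lexlead m (\sum_(i <- r | P i) c i) (\sum_(i <- r | P i) f i).
Proof.
move=> lead_f; apply: (big_rec2 (fun c f => lexlead m c f)); first exact: lexlead0.
by move=> i c' f' /lead_f; apply: lexleadD.
Qed.

Lemma lexlead_prod (I : Type) (r : seq I) (m : I -> 'X_{1..n}) (c : I -> k) (f : I -> A) :
  (forall i, lexlead (m i) (c i) (f i)) ->
  lexlead (\big[+%MM/0%MM]_(i <- r) m i) (\prod_(i <- r) c i) (\prod_(i <- r) f i).
Proof.
move=> lead_f; apply: (big_rec3 (fun m c f => lexlead m c f)); first exact: lexlead1.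
by move=> i m' c' f' _; apply: lexleadM.
Qed.

Lemma lexlead_exp m c f e : lexlead m c f -> lexlead (m *+ e)%MM (c ^+ e) (f ^+ e).
Proof.
move=> lead_f; elim: e => [|e IHe]; first by rewrite mulm0n !expr0; apply: lexlead1.
by rewrite mulmS !exprS; apply: lexleadM.
Qed.

Lemma lexlead_neq0 m c f : lexlead m c f -> c != 0 -> f != 0.
Proof.
move=> [g -> low_g] c_neq0; apply/eqP => /(congr1 (mcoeff m))/eqP.
rewrite mcoeffD mcoeffZ mcoeffX eqxx mulr1 mcoeff0.
suff -> : g@_m = 0 by rewrite addr0 (negPf c_neq0).
apply/eqP; rewrite mcoeff_eq0; apply/negP => /low_g[i].
by rewrite ltnn.
Qed.

Local Notation U phi := (\big[+%MM/0%MM]_x U_(phi x)%MM).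

(** Every pairing uses each argument once, so all products have the same leading monomial, and the
    coefficients add up to the Pfaffian sum of [L]. *)
Lemma lexlead_bivector_pow (pi : A -> A -> A) (L : 'I_n -> 'I_n -> k) r (phi : 'I_r.*2 -> 'I_n) :
  (forall i j, lexlead (U_(i) + U_(j))%MM (L i j) (pi 'X_i 'X_j)) ->
  lexlead (U phi) (pfaffian_sum L phi) (bivector_pow pi (fun x => 'X_(phi x))).
Proof.
move=> lead_pi; apply: lexlead_sum => s _; apply: lexlead_sign.
rewrite (reindex_inj (@perm_inj _ s)) big_pair.
by apply: (@lexlead_prod _ _ (fun i => U_(phi (s (pair_fst i))) + U_(phi (s (pair_snd i))))%MM) => i.
Qed.

Lemma lexlead_det l (w : 'I_l -> A -> A) (N : 'I_l -> 'I_n -> k) (phi : 'I_l -> 'I_n) :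
  (forall i j, w i 'X_j = N i j *: 'X_j) ->
  lexlead (U phi) (\det (\matrix_(i, j) N i (phi j))) (vf_wedge w (fun x => 'X_(phi x))).
Proof.
move=> wX; apply: lexlead_sum => s _; apply: lexlead_sign.
rewrite (reindex_inj (@perm_inj _ s)); apply: lexlead_prod => i.
by rewrite !mxE wX; exists 0; [rewrite addr0 | apply: lexlow0].
Qed.

Lemma lexlead_wedge (d l : nat) (P : mvfield k n d) (Q : mvfield k n l)
    (Pc : ('I_d -> 'I_n) -> k) (Qc : ('I_l -> 'I_n) -> k) phi :
  (forall phi, lexlead (U phi) (Pc phi) (P (fun x => 'X_(phi x)))) ->
  (forall phi, lexlead (U phi) (Qc phi) (Q (fun x => 'X_(phi x)))) ->
  lexlead (U phi) (shuffle_wedge Pc Qc phi) (mv_wedge P Q (fun x => 'X_(phi x))).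
Proof.
move=> leadP leadQ; apply: lexlead_sum => s _; apply: lexlead_sign.
rewrite (reindex_inj (@perm_inj _ s)) big_split_ord.
exact: lexleadM.
Qed.

Lemma mderivXU (i j : 'I_n) : ('X_j : A)^`M(i) = (j == i)%:R.
Proof.
rewrite mderivX mnm1E; case: eqP => [->|_]; last by rewrite scale0r.
by rewrite scale1r (_ : (U_(i) - U_(i))%MM = 0%MM) ?mpolyX0 //; apply/mnmP => l;
  rewrite mnmBE subnn mnm0E.
Qed.

Lemma bivectorX (c : 'I_n -> 'I_n -> A) i j :
  bivector c 'X_i 'X_j = if (i < j)%N then c i j else if (j < i)%N then - c j i else 0.
Proof.
have E (a b : 'I_n) : (a < b)%N ->
  c a b * (('X_i)^`M(a) * ('X_j)^`M(b) - ('X_i)^`M(b) * ('X_j)^`M(a)) =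
    (if (a == i) && (b == j) then c i j else 0) - (if (a == j) && (b == i) then c j i else 0).
  move=> lt_ab; rewrite !mderivXU ![_ == a]eq_sym ![_ == b]eq_sym; move: lt_ab.
  case: (eqVneq a i) => [ai|_]; case: (eqVneq b j) => [bj|_];
  case: (eqVneq a j) => [aj|_]; case: (eqVneq b i) => [bi|_] //=;
  by subst; rewrite ?ltnn //= => _; rewrite ?(mulr0, mul0r, mulr1, mulr1n, subr0, sub0r, mulrN1,
    subrr, oppr0, addr0).
pose S (i j : 'I_n) := if (i < j)%N then c i j else 0.
have sumE i' j' : \sum_(a < n) \sum_(b < n | (a < b)%N)
    (if (a == i') && (b == j') then c i' j' else 0) = S i' j'.
  rewrite (bigD1 i') //= [X in _ + X]big1 ?addr0 => [|a /negPf a_ne]; last first.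
    by apply: big1 => b _; rewrite a_ne.
  rewrite eqxx /= /S; case: ifP => lt_ij.
    by rewrite (bigD1 j') //= eqxx big1 ?addr0 // => b /andP[_ /negPf ->].
  by apply: big1 => b lt_b; case: eqP => // bj; rewrite -bj lt_b in lt_ij.
transitivity (S i j - S j i); last first.
  by rewrite /S; case: ltngtP => _; rewrite ?subr0 ?sub0r.
rewrite -!sumE -sumrB; apply: eq_bigr => a _; rewrite -sumrB.
by apply: eq_bigr => b lt_ab; rewrite E.
Qed.

End LexLead.

(** * The Cartier operator *)

Section Cartier.
Variables (k : closedFieldType) (n p : nat) (C : {mpoly k[n]} -> {mpoly k[n]}).
Hypothesis p_char : p \in [pchar k].
Hypothesis C_cartier : cartier_operator p C.
Implicit Types (m : 'X_{1..n}) (f g : {mpoly k[n]}).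

Let p_prime : prime p := pcharf_prime p_char.

Let mpoly_char : p \in [pchar {mpoly k[n]}].
Proof. by rewrite inE p_prime /= -mpolyC_nat pcharf0 // mpolyC0. Qed.

Lemma cartier_sum (I : Type) (r : seq I) (f : I -> {mpoly k[n]}) :
  C (\sum_(i <- r) f i) = \sum_(i <- r) C (f i).
Proof.
apply: (big_morph C (cartierD C_cartier)).
by apply: (addrI (C 0)); rewrite -(cartierD C_cartier) !addr0.
Qed.

Lemma jacobian_id : jacobian (fun i : 'I_n => 'X_i : {mpoly k[n]}) = 1.
Proof.
rewrite /jacobian (_ : \matrix_(i, j) _ = 1%:M) ?det1 //.
by apply/matrixP => i j; rewrite !mxE mderivXU.
Qed.

(** Derivations kill [p]-th powers, and [m i + 1] is invertible in [k], so a primitive in the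
    variable [x_i] is obtained by raising that exponent by one. *)
Lemma cartier_monomial_eq0 f c m (i : 'I_n) :
  ~~ (p %| (m i).+1)%N -> C (f ^+ p * (c *: 'X_[m])) = 0.
Proof.
rewrite (dvdn_pcharf p_char) => mi_neq0.
suff -> : f ^+ p * (c *: 'X_[m]) =
    (f ^+ p * ((c / (m i).+1%:R) *: 'X_[m + U_(i)]))^`M(i).
  exact: (cartier_exact C_cartier).
have fp0 : (f ^+ p)^`M(i) = 0.
  have der_exp e : (f ^+ e)^`M(i) = e%:R * (f ^+ e.-1 * f^`M(i)).
    elim: e => [|e IHe]; first by rewrite mul0r expr0 mderivC.
    rewrite exprS mderivM IHe /=; case: e IHe => [|e] IHe.
      by rewrite expr0 mulr1 mul0r mulr0 addr0 !mul1r.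
    by rewrite exprS; ring.
  by rewrite der_exp (pcharf0 mpoly_char) mul0r.
rewrite mderivM fp0 mul0r add0r mderivZ mderivX mnmDE mnm1E eqxx addn1 scalerA.
by rewrite addmK -mulrA mulVf ?mulr1.
Qed.

(** This is the inverse Cartier formula for the coordinate functions, whose Jacobian is 1. *)
Lemma cartier_frobenius f : C (f ^+ p * 'X_[(\big[+%MM/0%MM]_i U_(i) *+ p.-1)%MM]) = f.
Proof.
have := cartier_inverse C_cartier f (fun i => 'X_i).
rewrite jacobian_id !mulr1 => {2}<-; congr (C (_ * _)).
by rewrite prodrXl -mpolyXn mprodXE.
Qed.

(** It suffices to treat [g] a scaled monomial. If some [m i + 1] is prime to [p], both sides
    vanish; otherwise [g] is a [p]-th power times the [(p-1)]-st power of the product of all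
    variables, and [cartier_frobenius] applies twice. *)
Lemma cartierM f g : C (f ^+ p * g) = f * C g.
Proof.
suff monoE h c m : C (h ^+ p * (c *: 'X_[m])) = h * C (c *: 'X_[m]).
  rewrite (mpolyE g) mulr_sumr !cartier_sum mulr_sumr.
  by apply: eq_bigr => m _; apply: monoE.
have [all_div|/forallPn[i ndiv]] := boolP [forall i, p %| (m i).+1]%N; last first.
  rewrite (cartier_monomial_eq0 _ _ ndiv).
  by rewrite -['X_[m]]mul1r -(expr1n _ p) scalerAr (cartier_monomial_eq0 _ _ ndiv) mulr0.
have p_gt0 := prime_gt0 p_prime.
(* The coefficient has a [p]-th root because [k] is algebraically closed. *)
have [b cE] : exists b, b ^+ p = c.
  have [b bE] := @solve_monicpoly k p (fun i => if i == 0%N then c else 0) p_gt0.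
  exists b; rewrite bE -(prednK p_gt0) big_ord_recl /= expr0 mulr1 big1 ?addr0 //.
  by move=> i _; rewrite mul0r.
(* If [m i + 1 = p q] with [q > 0], then [m i = p (q - 1) + (p - 1)]. *)
pose m' := [multinom ((m i).+1 %/ p).-1 | i < n].
have mE : m = (m' *+ p + \big[+%MM/0%MM]_i U_(i) *+ p.-1)%MM.
  apply/mnmP => i; rewrite mnmDE !mulmnE mnmE mnm_sumE (bigD1 i) //= big1 => [|j /negPf ne_ji].
    have /divnK := forallP all_div i; rewrite mnm1E eqxx addn0 mul1n.
    by case: (_ %/ _)%N => [|q]; rewrite ?mul0n // mulSn /=; lia.
  by rewrite mnm1E ne_ji.
have -> : c *: 'X_[m] = (b *: 'X_[m']) ^+ p * 'X_[(\big[+%MM/0%MM]_i U_(i) *+ p.-1)%MM].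
  by rewrite {1}mE mpolyXD -mpolyXn exprZn cE scalerAl.
by rewrite mulrA -exprMn !cartier_frobenius.
Qed.

Lemma lexlead_splitting f :
  lexlead (\big[+%MM/0%MM]_i U_(i))%MM 1 f -> C (f ^+ p.-1) = 1.
Proof.
move=> /(lexlead_exp p.-1)[g -> low_g]; rewrite expr1n scale1r (cartierD C_cartier).
have := cartier_frobenius 1; rewrite expr1n mul1r => ->.
rewrite (mpolyE g) cartier_sum big_seq.
rewrite big1 ?addr0 // => m /low_g[i lt_i _].
rewrite -['X_[m]]mul1r -(expr1n _ p) scalerAr; apply: (@cartier_monomial_eq0 _ _ _ i).
(* The exponent satisfies [m i < p - 1], so [0 < m i + 1 < p] is not divisible by [p]. *)
move: lt_i; rewrite mulmnE mnm_sumE (bigD1 i) //= big1 => [|j /negPf ne_ji].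
  rewrite mnm1E eqxx addn0 mul1n => lt_i; apply/negP => /dvdn_leq; lia.
by rewrite mnm1E ne_ji.
Qed.

End Cartier.

(** * Rank of the log-canonical part and leading terms of the bivectors *)

(** The sum is an alternating form in [r.*2] vectors of a space of dimension [s.*2 < r.*2], where no
    increasing choice of basis vectors exists. Working over a domain allows polynomial entries. *)
Lemma pfaffian_sum_factor (R : idomainType) q s r (S : 'M[R]_(q, s.*2)) (J : 'M[R]_s.*2)
    (a : 'I_r.*2 -> 'rV[R]_q) :
  (2%:R : R) != 0 -> J^T = - J -> (s < r)%N ->
  pfaffian_sum (mxform (S *m J *m S^T)) a = 0.
Proof.
move=> two_neq0 J_skew lt_sr.
suff F0 b : pfaffian_sum (r := r) (mxform J) b = 0.
  rewrite -[RHS](F0 (fun i => a i *m S)); apply: eq_bigr => t _; congr (_ * _).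
  by apply: eq_bigr => i _; rewrite /mxform trmx_mul !mulmxA.
apply: multialt_eq0 => [|phi phi_incr].
  apply: pfaffian_sum_multialt => //; first by move=> x; apply: mxform_alt.
    by move=> *; apply: mxform_linearl.
  by move=> *; apply: mxform_linearr.
have r_gt0 : (0 < r.*2)%N by lia.
by have := increasing_le phi_incr (Ordinal r_gt0); rewrite /=; lia.
Qed.

Section LogCanonical.
Variables (k : fieldType) (n d : nat) (X : poissonCGL k n d).

Definition log_canonical_mx : 'M[k]_n := \matrix_(i, j)
  if (i < j)%N then cgl_lambda X j (cgl_h X i)
  else if (j < i)%N then - cgl_lambda X i (cgl_h X j) else 0.

Lemma log_canonical_mx_skew : log_canonical_mx^T = - log_canonical_mx.
Proof. by apply/matrixP => i j; rewrite !mxE; case: ltngtP; rewrite ?opprK ?oppr0. Qed.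

(** In the logarithmic derivatives [x_i df/dx_i] the bivector [pi0] has constant coefficients. The
    formula covers arbitrary functions, because the rank tests all of them and not only the
    variables. *)
Lemma cgl_pi0_mxform f g : cgl_pi0 X f g =
  mxform (map_mx (@mpolyC n k) log_canonical_mx)
    (\row_i ('X_i * f^`M(i))) (\row_i ('X_i * g^`M(i))).
Proof.
pose t i j := (log_canonical_mx i j) *: ('X_i * f^`M(i) * ('X_j * g^`M(j))).
transitivity (\sum_i \sum_j t i j); last first.
  rewrite exchange_big /mxform mxE; apply: eq_bigr => j _; rewrite !mxE mulr_suml.
  apply: eq_bigr => i _; rewrite !mxE /t -mul_mpolyC.
  by rewrite mxE mulrC [RHS]mulrAC.
(* The double sum is split at the diagonal, where [L] is zero. *)
have -> : \sum_i \sum_j t i j =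
    \sum_(i < n) \sum_(j < n | (i < j)%N) t i j + \sum_(i < n) \sum_(j < n | (i < j)%N) t j i.
  rewrite [X in _ + X](exchange_big_dep xpredT) //= -big_split /=; apply: eq_bigr => i _.
  rewrite (bigID (fun j : 'I_n => (i < j)%N)) /=; congr (_ + _).
  rewrite (bigID (fun j : 'I_n => (j < i)%N)) /= [X in _ + X]big1 ?addr0.
    by apply: eq_bigl => j; case: ltngtP.
  by move=> j; case: ltngtP => // ji _; rewrite /t mxE ji ltnn scale0r.
rewrite -big_split; apply: eq_bigr => i _; rewrite -big_split; apply: eq_bigr => j lt_ij.
rewrite /t !mxE lt_ij ltnNge (ltnW lt_ij) /= scaleNr -scalerBr -scalerAl; congr (_ *: _).
ring.
Qed.

Lemma lexlead_bivector (c : 'I_n -> 'I_n -> {mpoly k[n]}) :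
  (forall i j : 'I_n, (i < j)%N -> lexlead (U_(i) + U_(j))%MM (log_canonical_mx i j) (c i j)) ->
  forall i j, lexlead (U_(i) + U_(j))%MM (log_canonical_mx i j) (bivector c 'X_i 'X_j).
Proof.
move=> lead_c i j; rewrite bivectorX; have [lt_ij|lt_ji|eq_ij] := ltngtP i j.
- exact: lead_c.
- have -> : log_canonical_mx i j = -1 * log_canonical_mx j i.
    by rewrite !mxE lt_ji ltnNge (ltnW lt_ji) mulN1r.
  by rewrite -scaleN1r addmC; apply: lexleadZ; apply: lead_c.
- by rewrite mxE eq_ij ltnn; apply: lexlead0.
Qed.

Lemma lexlead_cgl_pi0 i j :
  lexlead (U_(i) + U_(j))%MM (log_canonical_mx i j) (cgl_pi0 X 'X_i 'X_j).
Proof.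
apply: lexlead_bivector => {}i {}j lt_ij; rewrite mxE lt_ij.
by exists 0; [rewrite addr0 mpolyXD | apply: lexlow0].
Qed.

(** For [i < j], the monomials of [delta_i(x_j)] involve only variables strictly between [x_i] and
    [x_j]. They agree with [x_i x_j] before position [i] and have the smaller exponent 0 there. *)
Lemma lexlead_cgl_pi i j :
  lexlead (U_(i) + U_(j))%MM (log_canonical_mx i j) (cgl_pi X 'X_i 'X_j).
Proof.
apply: lexlead_bivector => {}i {}j lt_ij; rewrite mxE lt_ij.
exists (cgl_delta X i 'X_j); first by rewrite mpolyXD.
move=> m /(allP (cgl_delta_var X lt_ij))/forallP vars_m.
have m0 (l : 'I_n) : ~~ (i < l < j)%N -> m l = 0%N.
  by move=> l_out; apply/eqP; apply: contraNT l_out => ml; apply: (implyP (vars_m l)).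
exists i => [|l lt_li]; rewrite m0 ?mnmDE ?mnm1E ?eqxx ?ltnn //;
  last by rewrite ltnNge (ltnW lt_li).
by rewrite -!val_eqE /= (gtn_eqF lt_li) gtn_eqF // (ltn_trans lt_li).
Qed.

End LogCanonical.

(** * Construction of the Frobenius Poisson Pfaffian *)

Theorem theoremC (k : closedFieldType) (p n d : nat)
    (hp : p \in [pchar k]) (hp2 : (2 < p)%N)
    (C : {mpoly k[n]} -> {mpoly k[n]}) (hC : cartier_operator p C)
    (X : poissonCGL k n d) (m : nat)
    (hpi : has_rank (cgl_pi X) m) (hpi0 : has_rank (cgl_pi0 X) m) :
  exists sigma : mvfield k n n, frobenius_poisson_pfaffian p C X sigma.
Proof.
have two_neq0 : (2%:R : k) != 0.
  by rewrite -(dvdn_pcharf hp); apply/negP => /dvdn_leq; lia.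
have mpoly_two_neq0 : (2%:R : {mpoly k[n]}) != 0 by rewrite -mpolyC_nat mpolyC_eq0.
pose L := log_canonical_mx X.
pose M : 'M[k]_n := \matrix_(i, j) cgl_lambda X j (cgl_h X i).
have ML (i j : 'I_n) : (i < j)%N -> L i j = M i j by move=> lt_ij; rewrite !mxE lt_ij.
have M_diag i : M i i != 0 by rewrite mxE; apply: cgl_diag.
have [s [l [e [G [[S L_fact] s0_neq0]]]]] :=
  transversal_exists two_neq0 (log_canonical_mx_skew X) ML M_diag.
(* The factorisation of [L] through [s.*2] columns kills all higher powers of [pi0]. Conversely, a
   non-zero term of the sum in [s0_neq0] contains a non-zero Pfaffian of [L], the leading
   coefficient of a value of [pi0^[s]]. *)
have rank_s : m = s.*2.
  have [r [mE [a pi0_a] max_r]] := hpi0; rewrite mE; congr double.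
  apply/eqP; rewrite eqn_leq; apply/andP; split.
    rewrite leqNgt; apply/negP => lt_sr; case/eqP: pi0_a.
    transitivity (pfaffian_sum (r := r) (mxform (map_mx (@mpolyC n k) L))
      (fun x => \row_i ('X_i * (a x)^`M(i)))).
      apply: eq_bigr => t _; congr (_ * _); apply: eq_bigr => i _.
      exact: cgl_pi0_mxform.
    rewrite /L L_fact !map_mxM -map_trmx; apply: pfaffian_sum_factor => //.
    by rewrite map_trmx symplectic_mx_tr map_mxN.
  apply: max_r.
  have /existsP[phi phi_neq0] : [exists phi : {ffun 'I_s.*2 -> 'I_n}, pfaffian_sum (r :=
    s) L phi != 0].
    apply: contraNT s0_neq0 => /existsPn no_phi; apply/eqP/big1 => t _.
    have /negPn/eqP := no_phi [ffun i => cast_ord e (t (lshift l i))].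
    have -> : [ffun i => cast_ord e (t (lshift l i))] = (fun i => cast_ord e (t (lshift l i))) :> (_ -> _).
      by apply: functional_extensionality => i; rewrite ffunE.
    by move=> ->; rewrite mul0r mulr0.
  exists (fun x => 'X_(phi x)); apply: lexlead_neq0 phi_neq0.
  exact: lexlead_bivector_pow (lexlead_cgl_pi0 X).
(* The row [i] of [G] gives the combination of the [h_a]; by linearity its vector field scales [x_j]
   by the entry [(i, j)] of [G *m M]. *)
pose g i : 'rV[k]_d := row i (G *m \matrix_a cgl_h X a).
have gX i j : generated_vf X (g i) 'X_j = (G *m M) i j *: 'X_j.
  rewrite /generated_vf (bigD1 j) //= big1 ?addr0 => [|a /negPf ne_aj]; last first.
    by rewrite mderivXU eq_sym ne_aj mulr0 scaler0.
  rewrite mderivXU eqxx mulr1; congr (_ *: _); rewrite /cgl_lambda /dchar.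
  rewrite [RHS]mxE (eq_bigr (fun b => \sum_a G i a * ((cgl_wt X j 0 b)%:~R * cgl_h X a 0 b))) =>
    [|b _].
    by rewrite exchange_big; apply: eq_bigr => a _; rewrite mxE mulr_sumr.
  by rewrite !mxE mulr_sumr; apply: eq_bigr => a _; rewrite mxE mulrCA.
pose sigma : mvfield k n n := fun a =>
  mv_wedge (@bivector_pow k n (cgl_pi X) s) (vf_wedge (fun i => generated_vf X (g i)))
    (fun i => a (cast_ord e i)).
set s0 := shuffle_wedge _ _ _ in s0_neq0.
have lead_sigma : lexlead (\big[+%MM/0%MM]_i U_(i))%MM s0 (gamma_pairing sigma).
  have -> : \big[+%MM/0%MM]_(i < n) U_(i)%MM = \big[+%MM/0%MM]_x U_(cast_ord e x)%MM.
    by apply: reindex; exists (cast_ord (esym e)) => i _; rewrite ?cast_ordK ?cast_ordKV.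
  apply: lexlead_wedge => phi; last exact: lexlead_det.
  exact: lexlead_bivector_pow (lexlead_cgl_pi X).
exists sigma; split.
  split; first by exists (fun i => 'X_i); apply: lexlead_neq0 lead_sigma s0_neq0.
  (* Here the equality of ranks enters: [pi] also has rank [s.*2]. *)
  by exists s, l, e, g; split; first by rewrite -rank_s.
(* This scalar makes the leading coefficient of the section equal to 1. *)
exists s0^-1; first by rewrite invr_eq0.
have C1 : C (gamma_pairing (mv_scale s0^-1 sigma) ^+ p.-1) = 1.
  apply: (lexlead_splitting hp hC); rewrite -(mulVf s0_neq0).
  exact: lexleadZ.
split=> [|f]; rewrite /anticanonical_near_splitting /section_near_splitting.
  split=> f h; first by rewrite mulrDl (cartierD hC).
  by rewrite -mulrA (cartierM hp hC).
by rewrite (cartierM hp hC) C1 mulr1.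
Qed.
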